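(* Consider the Fibonacci sequence $f_1:=1$, $f_2:=1$, and $f_j:=f_{j-1}+f_{j-2}$ for $j>2$. Let $l\geq 4$ be an even integer and let $$\Gamma=\{(1,0),(f_1,f_2),(f_3,f_4),\ldots,(f_{l-1},f_{l})\}\subset\mathbb{Z}^2.$$ Then two iterations of the Nash blowup resolve the singularities of the toric surface $X_\Gamma$ defined by $\Gamma$.
   Context: Toric variety. For a finite set $\Gamma=\{\gamma_1,\ldots,\gamma_n\}\subset\mathbb{Z}^d$, let $\pi_\Gamma:\mathbb{N}^n\to\mathbb{Z}^d$, $\pi_\Gamma(\alpha)=\alpha_1\gamma_1+\cdots+\alpha_n\gamma_n$ (with $0\in\mathbb{N}$), and let $I_\Gamma=\langle x^\alpha-x^\beta\mid \alpha,\beta\in\mathbb{N}^n,\ \pi_\Gamma(\alpha)=\pi_\Gamma(\beta)\rangle\subset\mathbb{C}[x_1,\ldots,x_n]$. The toric variety defined by $\Gamma$ is $X_\Gamma:=\mathbf{V}(I_\Gamma)\subset\mathbb{C}^n$. Nash blowup. Let $X\subset\mathbb{C}^n$ be an irreducible algebraic variety of dimension $d$, with singular locus $\operatorname{Sing}(X)$. Let $\operatorname{Gr}(d,n)$ be the Grassmannian of $d$-dimensional vector subspaces of $\mathbb{C}^n$, and let $G:X\setminus\operatorname{Sing}(X)\to\operatorname{Gr}(d,n)$, $x\mapsto T_xX$, be the Gauss map. Let $X^*$ be the Zariski closure of the graph of $G$ in $X\times\operatorname{Gr}(d,n)$ and $\nu:X^*\to X$ the restriction of the projection. The pair $(X^*,\nu)$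 is the Nash blowup of $X$. The construction is local on $X$ and independent of the embedding, so by gluing over an affine open covering it also applies to non-affine varieties, in particular to $X^*$, and can be iterated (without normalizing). ''Two iterations of the Nash blowup resolve the singularities of $X$'' means that the Nash blowup of the Nash blowup of $X$ is a non-singular variety. *)

(* Defs.v *)
(* World: MathComp (multinomials for polynomials, boolp for classical sets). *)
From mathcomp Require Import all_boot all_order all_algebra.
From mathcomp Require Import boolp classical_sets reals.
From mathcomp Require Import complex.
From mathcomp Require Import mpoly.

Set Implicit Arguments.
Unset Strict Implicit.
Unset Printing Implicit Defensive.

Import GRing.Theory.

Local Open Scope ring_scope.

Section AffineVarieties.
Context {C : fieldType}.

Definition zero_locus n (I : set {mpoly C[n]}) : set 'rV[C]_n :=
  fun x => forall f, I f -> f.@[x ord0] = 0.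

Definition vanishing_ideal n (X : set 'rV[C]_n) : set {mpoly C[n]} :=
  fun f => forall x, X x -> f.@[x ord0] = 0.

Definition zariski_closed n (A : set 'rV[C]_n) : Prop :=
  exists I : set {mpoly C[n]}, A = zero_locus I.

Definition ideal_gen n (S : set {mpoly C[n]}) : set {mpoly C[n]} :=
  fun f => exists s : seq ({mpoly C[n]} * {mpoly C[n]}),
    (forall gh, gh \in s -> S gh.2) /\ f = \sum_(gh <- s) gh.1 * gh.2.

(* The restrictions to X of f_0, ..., f_(e-1) are algebraically independent
   elements of the coordinate ring of X. *)
Definition alg_independent n (X : set 'rV[C]_n) e (f : 'I_e -> {mpoly C[n]}) :=
  forall P : {mpoly C[e]},
    (forall x, X x -> P.@[fun i => (f i).@[x ord0]] = 0) -> P = 0.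

(* Transcendence degree over C of the coordinate ring of X (equivalently, for X
   irreducible, of its function field).  It is at most n, so the range of the
   maximum loses nothing.  The empty set gets the junk value 0. *)
Definition dimension n (X : set 'rV[C]_n) : nat :=
  \max_(e < n.+1 |
     `[< exists f : 'I_e -> {mpoly C[n]}, alg_independent X f >]) e.

(* W is the Zariski tangent space of X at x. *)
Definition is_tangent_space n (X : set 'rV[C]_n) (x : 'rV[C]_n)
    (W : {vspace 'rV[C]_n}) : Prop :=
  forall v : 'rV[C]_n,
    v \in W <-> (forall f, vanishing_ideal X f ->
                   \sum_(i < n) (f^`M(i)).@[x ord0] * v ord0 i = 0).

Definition nonsingular_at n (X : set 'rV[C]_n) (x : 'rV[C]_n) : Prop :=
  X x /\ exists W, is_tangent_space X x W /\ \dim W = dimension X.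

End AffineVarieties.

Section Grassmannian.
Context {C : fieldType}.

(* A point of Gr(d, n) is a W : {vspace 'rV_n} with \dim W = d. *)

Definition row_space m n (B : 'M[C]_(m, n)) : {vspace 'rV[C]_n} :=
  <<[seq row i B | i <- enum 'I_m]>>%VS.

(* For J a set of d coordinates, the standard affine open U_J of Gr(d, n)
   consists of the W projecting isomorphically onto the coordinates in J.  Such a
   W is the row space of exactly one J-normalized matrix, whose rows outside J
   are padding; the free entries B i j, with i in J and j not in J, are the usual
   d * (n - d) affine coordinates on U_J. *)
Definition normalized n (J : {set 'I_n}) (B : 'M[C]_n) : Prop :=
  forall i j, (i \notin J -> B i j = 0) /\
              (i \in J -> j \in J -> B i j = (i == j)%:R).

Definition pt_coord n (y : 'rV[C]_(n + n * n)) : 'rV[C]_n := lsubmx y.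
Definition mx_coord n (y : 'rV[C]_(n + n * n)) : 'M[C]_n := vec_mx (rsubmx y).

(* Z intersected with C^n x U_J, as a subset of the affine space C^(n + n^2), in
   which C^n x U_J sits as a linear subvariety. *)
Definition gr_chart n (J : {set 'I_n})
    (Z : set ('rV[C]_n * {vspace 'rV[C]_n})) : set 'rV[C]_(n + n * n) :=
  fun y => normalized J (mx_coord y) /\ Z (pt_coord y, row_space (mx_coord y)).

(* Zariski-closed subsets of C^n x Gr(d, n). *)
Definition gr_closed n d (Z : set ('rV[C]_n * {vspace 'rV[C]_n})) : Prop :=
  (forall p, Z p -> \dim p.2 = d) /\
  (forall J : {set 'I_n}, #|J| = d -> zariski_closed (gr_chart J Z)).

Definition gauss_graph n (X : set 'rV[C]_n) :
    set ('rV[C]_n * {vspace 'rV[C]_n}) :=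
  fun p => nonsingular_at X p.1 /\ is_tangent_space X p.1 p.2.

(* The closure of the graph of the Gauss map in X x Gr(dimension X, n). *)
Definition affine_nash n (X : set 'rV[C]_n) :
    set ('rV[C]_n * {vspace 'rV[C]_n}) :=
  fun p => X p.1 /\ \dim p.2 = dimension X /\
    (forall Z, gr_closed (dimension X) Z ->
       (forall q, gauss_graph X q -> Z q) -> Z p).

End Grassmannian.

(* A variety obtained by gluing affine varieties piece i in C^(adim i);
   glue i j x y says that x in piece i and y in piece j are the same point. *)
Record variety (C : fieldType) := Variety {
  pieces : Type;
  adim : pieces -> nat;
  piece : forall i, set 'rV[C]_(adim i);
  glue : forall i j, 'rV[C]_(adim i) -> 'rV[C]_(adim j) -> Prop }.

Section NashBlowup.
Context {C : fieldType}.

Definition affine_variety n (X : set 'rV[C]_n) : variety C :=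
  @Variety C unit (fun _ => n) (fun _ => X) (fun _ _ x y => X x /\ x = y).

Definition nonsingular (V : variety C) : Prop :=
  forall (i : pieces V) x, piece x -> nonsingular_at (@piece C V i) x.

Definition rat_map m n (p : 'I_m -> {mpoly C[n]}) (q : {mpoly C[n]})
    (x : 'rV[C]_n) : 'rV[C]_m :=
  \row_k ((p k).@[x ord0] / q.@[x ord0]).

(* Row i, column k: the derivative of p k / q with respect to the i-th variable,
   so that the differential is right multiplication of row vectors. *)
Definition rat_diff m n (p : 'I_m -> {mpoly C[n]}) (q : {mpoly C[n]})
    (x : 'rV[C]_n) : 'M[C]_(n, m) :=
  \matrix_(i, k) (((p k)^`M(i) * q - p k * q^`M(i)).@[x ord0] / q.@[x ord0] ^+ 2).

(* The Nash blowups of the pieces of V, each covered by its affine opens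
   gr_chart J; the charts with #|J| different from the dimension are empty.
   Points (x, W) over piece i and (x', W') over piece i' are identified when the
   transition map of V from piece i to piece i', written p / q near x, sends x
   to x' and its differential at x sends W to W'. *)
Definition nash_blowup (V : variety C) : variety C :=
  @Variety C {i : pieces V & {set 'I_(adim i)}}
    (fun iJ => adim (tag iJ) + adim (tag iJ) * adim (tag iJ))%N
    (fun iJ => gr_chart (tagged iJ) (affine_nash (@piece C V (tag iJ))))
    (fun iJ jK y z =>
       [/\ gr_chart (tagged iJ) (affine_nash (@piece C V (tag iJ))) y,
           gr_chart (tagged jK) (affine_nash (@piece C V (tag jK))) z &
           exists (p : 'I_(adim (tag jK)) -> {mpoly C[adim (tag iJ)]})
                  (q : {mpoly C[adim (tag iJ)]}),
             [/\ q.@[pt_coord y ord0] != 0,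
                 forall x, piece x -> q.@[x ord0] != 0 -> glue x (rat_map p q x),
                 pt_coord z = rat_map p q (pt_coord y) &
                 row_space (mx_coord z) =
                   row_space (mx_coord y *m rat_diff p q (pt_coord y))]]).

End NashBlowup.

Section Toric.
Context {C : fieldType}.

Definition toric_degree n d (Gamma : 'I_n -> 'rV[int]_d) (a : 'X_{1..n}) :
    'rV[int]_d :=
  \sum_(i < n) Gamma i *+ a i.

Definition toric_ideal n d (Gamma : 'I_n -> 'rV[int]_d) : set {mpoly C[n]} :=
  ideal_gen (fun f => exists a b : 'X_{1..n},
    toric_degree Gamma a = toric_degree Gamma b /\ f = 'X_[a] - 'X_[b]).

Definition toric_variety n d (Gamma : 'I_n -> 'rV[int]_d) : set 'rV[C]_n :=
  zero_locus (toric_ideal Gamma).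

End Toric.

(* The value at 0 makes the recursion hold already for fib 2. *)
Fixpoint fib (j : nat) : nat :=
  match j with
  | 0 => 0
  | 1 => 1
  | (k.+1 as m).+1 => fib m + fib k
  end.

(* (1, 0) at index 0 and (f_(2k-1), f_(2k)) at index k, for 1 <= k <= l / 2. *)
Definition fib_Gamma (l : nat) (k : 'I_(l./2).+1) : 'rV[int]_2 :=
  \row_(c < 2)
    (if k == 0 :> nat then if c == 0 :> nat then 1%:Z else 0%:Z
     else if c == 0 :> nat then (fib (k.*2).-1)%:Z else (fib k.*2)%:Z).
Arguments fib_Gamma : clear implicits.

(* Main.v *)
Require Import Defs.
From mathcomp Require Import all_boot all_order all_algebra.
From mathcomp Require Import boolp classical_sets reals complex.
From mathcomp Require Import mpoly.
From mathcomp Require Import zify ring.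

(** The exponents g_0 = (1,0), g_k = (f_(2k-1), f_(2k)) satisfy
    g_k + g_(k+2) = 3 g_(k+1) and det (g_k, g_(k+1)) = 1, and this is all that
    the argument uses of them, apart from the fact that there are at least three.

    Geometry.  All the varieties met on the way are closures of the image of the
    torus of characters chi of Z^2 under a map chi |-> (c_k chi(delta_k))_k, for
    some exponents delta_k in Z^2 and constants c_k, possibly zero ([toric]).  At
    such a point the tangent space is spanned by the two rows
    (c_k chi(delta_k) (delta_k)_a)_k, a = 1, 2 ([torus_tangent]).  By Cramer's
    rule its coordinates in the Grassmannian chart given by coordinates i, j are
    constants times chi(delta_k - delta_i) and chi(delta_k - delta_j).  Hence a
    chart of the Nash blowup is again of the same kind ([nash_toric]), and its
    exponents are obtained from the old ones by a combinatorial rule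
    ([nash_exps]).  That the chart satisfies every polynomial equation satisfied
    on the torus is the one delicate point ([nash_chart_closure]): near a smooth
    point of a variety, the tangent space is a rational function of the point,
    so an equation which holds over a dense subset holds over all smooth
    points, and then on the closure of the graph of the Gauss map.

    Smoothness.  If the exponents span a copy of N^2, N x Z or Z^2, a tangent
    vector killed by the differentials of two monomial functions is zero, so
    tangent spaces have dimension at most 2 ([toric_smooth]); they have dimension
    at least 2 because this holds on the torus and the dimension of the tangent
    space can only jump up ([tangent_semicontinuous]).

    Combinatorics ([two_steps_smooth]).  In the chart of the first blowup given
    by g_i and g_j with j > i + 1, the exponents include g_i and g_(i+1), and
    some sum of exponents is - g_(i+1), so this chart is already smooth, and so
    are the charts above it.  In the chart given by g_k and g_(k+1), the exponents span
    the semigroup of lattice points over a segment of lattice length 3 or 5 at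
    height 1: the chart is the cone over a rational normal curve of degree 3 or
    5.  The Nash blowup of such a cone is smooth ([cone_smooth]): its
    charts contain a unit of the form chi(u), except the two charts at the
    ends of the segment, which are affine planes. *)

Set Implicit Arguments.
Unset Strict Implicit.
Unset Printing Implicit Defensive.

Import Order.TTheory GRing.Theory Num.Theory.
Local Open Scope ring_scope.

(** * Row spaces and coordinate projections *)

Section LinearAlgebra.
Context {C : fieldType}.

Lemma mem_row_space m n (B : 'M[C]_(m, n)) (v : 'rV[C]_n) :
  (v \in row_space B) = (v <= B)%MS.
Proof.
apply/idP/idP => [|/submxP[u ->]].
  rewrite /row_space; set X := [seq _ | _ <- _] => vX.
  rewrite (@coord_span _ _ _ (in_tuple X) v) //.
  apply: summx_sub => k _; apply: scalemx_sub.
  have /mapP[i _ ->] : (in_tuple X)`_k \in X by apply: mem_nth.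
  exact: row_sub.
rewrite mulmx_sum_row; apply: memv_suml => i _; apply/memvZ/memv_span.
by apply: map_f; rewrite mem_enum.
Qed.

Lemma dim_row_space m n (B : 'M[C]_(m, n)) : \dim (row_space B) = \rank B.
Proof.
have [f fE] : exists f : 'Hom('rV[C]_(\rank B), 'rV[C]_n),
    forall u, f u = u *m row_base B.
  by exists (linfun (mulmxr (row_base B))) => u; rewrite lfunE.
have -> : row_space B = limg f.
  apply/vspaceP => v; rewrite mem_row_space -(eq_row_base B).
  apply/submxP/memv_imgP => [[u ->]|[u _ ->]]; exists u; rewrite ?memvf ?fE //.
rewrite limg_dim_eq ?dimvf /dim /= ?mul1n //.
apply/eqP; rewrite -subv0; apply/subvP => u; rewrite memv_cap memv_ker fE.
case/andP=> _ /eqP u0; rewrite memv0; apply/eqP.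
by apply: (row_free_inj (row_base_free B)); rewrite u0 mul0mx.
Qed.

Lemma row_space_eqmx m m' n (A : 'M[C]_(m, n)) (B : 'M[C]_(m', n)) :
  (A :=: B)%MS -> row_space A = row_space B.
Proof. by move=> AB; apply/vspaceP => v; rewrite !mem_row_space AB. Qed.

(** A matrix of maximal rank among those whose row space lies in [P] works: a
    further vector of [P] could be added to it. *)
Lemma subspace_mx n (P : 'rV[C]_n -> Prop) :
  P 0 -> (forall a u v, P u -> P v -> P (a *: u + v)) ->
  exists M : 'M[C]_n, forall v, (v <= M)%MS <-> P v.
Proof.
move=> P0 Plin.
pose Q r := `[< exists2 M : 'M[C]_n, \rank M = r & forall v, (v <= M)%MS -> P v >].
have Qex : exists r, Q r.
  exists 0%N; apply/asboolP; exists 0; rewrite ?mxrank0 // => v.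
  by rewrite submx0 => /eqP->.
have Qn r : Q r -> (r <= n)%N by move/asboolP => [M <- _]; exact: rank_leq_row.
case: (ex_maxnP Qex Qn) => r /asboolP[M rM MP] rmax.
exists M => v; split=> [|Pv]; first exact: MP.
have PMv u : (u <= M + v)%MS -> P u.
  case/sub_addsmxP=> -[a b] /= ->; rewrite addrC.
  have -> : b *m v = b 0 0 *: v.
    by rewrite [b in LHS]mx11_scalar mul_scalar_mx.
  by apply: Plin => //; apply: MP; rewrite submxMl.
have /rmax : Q (\rank (M + v)%MS) by apply/asboolP; exists (M + v)%MS.
rewrite -rM => rle; apply: submx_trans (addsmxSr M v) _.
by rewrite -(geq_leqif (mxrank_leqif_sup (addsmxSl M v))).
Qed.

Lemma subspace_vs n (P : 'rV[C]_n -> Prop) :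
  P 0 -> (forall a u v, P u -> P v -> P (a *: u + v)) ->
  exists W : {vspace 'rV[C]_n}, forall v, v \in W <-> P v.
Proof.
by move=> P0 Pl; have [M MP] := subspace_mx P0 Pl; exists (row_space M) => v;
  rewrite mem_row_space.
Qed.

(** The columns of the cokernel of [M] are orthogonal to the rows of [M], and
    membership in the row space of [M] is orthogonality to these columns. *)
Lemma sub_biorthogonal m n (M : 'M[C]_(m, n)) (u : 'rV[C]_n) :
  (forall w : 'rV[C]_n, M *m w^T = 0 -> u *m w^T = 0) -> (u <= M)%MS.
Proof.
move=> H; rewrite submxE; apply/eqP/rowP => j.
pose w := row j (cokermx M)^T.
have wE p (A : 'M[C]_(p, n)) i : (A *m w^T) i 0 = (A *m cokermx M) i j.
  by rewrite !mxE; apply: eq_bigr => k _; rewrite !mxE.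
rewrite -wE H; first by rewrite !mxE.
by apply/colP => i; rewrite wE mulmx_coker !mxE.
Qed.

(** Restriction to the coordinates in [J] is multiplication by this idempotent.
    Submatrices then stay square of size [n], and the charts for various [J] can
    be compared inside one matrix ring. *)
Definition coord_proj n (J : {set 'I_n}) : 'M[C]_n :=
  \matrix_(k, l) ((k == l) && (k \in J))%:R.

Lemma mul_coord_proj m n (J : {set 'I_n}) (A : 'M[C]_(m, n)) k l :
  (A *m coord_proj J) k l = A k l *+ (l \in J).
Proof.
rewrite mxE (bigD1 l) //= big1 ?addr0 => [|i /negPf il].
  by rewrite mxE eqxx mulr_natr.
by rewrite mxE il mulr0.
Qed.

Lemma coord_proj_mul m n (J : {set 'I_n}) (A : 'M[C]_(n, m)) k l :
  (coord_proj J *m A) k l = A k l *+ (k \in J).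
Proof.
rewrite mxE (bigD1 k) //= big1 ?addr0 => [|i /negPf il].
  by rewrite mxE eqxx mulr_natl.
by rewrite mxE eq_sym il mul0r.
Qed.

Lemma coord_proj_tr n (J : {set 'I_n}) : (coord_proj J)^T = coord_proj J.
Proof.
apply/matrixP => k l; rewrite !mxE eq_sym.
by case: eqP => // ->.
Qed.

Lemma coord_proj_idem n (J : {set 'I_n}) : coord_proj J *m coord_proj J = coord_proj J.
Proof.
by apply/matrixP => k l; rewrite mul_coord_proj !mxE; case: eqP => [->|]; case: (l \in J).
Qed.

Lemma normalizedP n (J : {set 'I_n}) (B : 'M[C]_n) :
  normalized J B <-> coord_proj J *m B = B /\ B *m coord_proj J = coord_proj J.
Proof.
split=> [nB|[EB BE] k l]; last first.
  split=> [kJ|kJ lJ]; first by rewrite -EB coord_proj_mul (negPf kJ).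
  by move/matrixP/(_ k l): BE; rewrite mul_coord_proj lJ !mxE kJ andbT.
split; apply/matrixP => k l; rewrite ?mul_coord_proj ?coord_proj_mul ?mxE.
  by case: (boolP (k \in J)) => // /(proj1 (nB k l))->.
case: (boolP (k \in J)) (nB k l) => kJ [n1 n2].
  rewrite andbT; case: (boolP (l \in J)) => lJ; first by rewrite n2.
  by case: eqP => // kl; rewrite -kl kJ in lJ.
by rewrite n1 // mul0rn andbF.
Qed.

(** [U] is the inclusion of the coordinates in [J]; it serves to match two sets
    of coordinates of the same size. *)
Lemma coord_proj_split n (J : {set 'I_n}) :
  exists U : 'M[C]_(n, #|J|), U^T *m U = 1%:M /\ U *m U^T = coord_proj J.
Proof.
exists (\matrix_(k, a) (k == enum_val a)%:R).
split; apply/matrixP => a b; rewrite !mxE.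
  rewrite (bigD1 (enum_val a)) //= big1 ?addr0 => [|i /negPf ia].
    by rewrite !mxE eqxx mul1r (inj_eq enum_val_inj).
  by rewrite !mxE ia mul0r.
case: (boolP (a \in J)) => aJ.
  rewrite (bigD1 (enum_rank_in aJ a)) //= big1 ?addr0 => [|i ia].
    by rewrite !mxE enum_rankK_in // eqxx mul1r andbT eq_sym.
  rewrite !mxE; case: eqP => [ai|]; rewrite ?mul0r //.
  move: ia; rewrite (_ : i = enum_rank_in aJ a) ?eqxx //.
  by apply: enum_val_inj; rewrite enum_rankK_in // -ai.
rewrite andbF big1 // => i _; rewrite !mxE; case: eqP => [ai|]; rewrite ?mul0r //.
by rewrite ai enum_valP in aJ.
Qed.

Lemma rank_coord_proj n (J : {set 'I_n}) : \rank (coord_proj J) = #|J|.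
Proof.
have [U [UU <-]] := coord_proj_split J.
apply/eqP; rewrite eqn_leq; apply/andP; split.
  by apply: leq_trans (mxrankM_maxl _ _) _; exact: rank_leq_col.
rewrite -[X in (X <= _)%N](@mxrank1 C) -UU -[U^T *m U]mulmx1 -UU.
by rewrite mulmxA -(mulmxA U^T) -(mulmxA U^T); apply: leq_trans (mxrankM_maxr _ _) (mxrankM_maxl _ _).
Qed.

Lemma rank_normalized n (J : {set 'I_n}) (B : 'M[C]_n) :
  normalized J B -> \rank B = #|J|.
Proof.
case/normalizedP => EB BE; rewrite -rank_coord_proj; apply/eqP; rewrite eqn_leq.
by rewrite -{1}EB -{3}BE mxrankM_maxl mxrankM_maxl.
Qed.

End LinearAlgebra.

(** * Tangent and conormal spaces *)

Section Tangent.
Context {C : fieldType}.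
Implicit Types (n : nat).

Definition grad n (f : {mpoly C[n]}) (x : 'rV[C]_n) : 'rV[C]_n :=
  \row_i (f^`M(i)).@[x ord0].

Definition dird n (f : {mpoly C[n]}) (x v : 'rV[C]_n) : C :=
  \sum_(i < n) (f^`M(i)).@[x ord0] * v ord0 i.

Lemma grad_dird n (f : {mpoly C[n]}) x v : (grad f x *m v^T) 0 0 = dird f x v.
Proof. by rewrite mxE; apply: eq_bigr => i _; rewrite !mxE. Qed.

Lemma grad_lin n a (f g : {mpoly C[n]}) x :
  grad (a *: f + g) x = a *: grad f x + grad g x.
Proof. by apply/rowP => i; rewrite !mxE mderivD mderivZ mevalD mevalZ. Qed.

Lemma grad0 n x : grad (0 : {mpoly C[n]}) x = 0.
Proof. by apply/rowP => i; rewrite !mxE mderiv0 meval0. Qed.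

Lemma dirdB n (f g : {mpoly C[n]}) x v : dird (f - g) x v = dird f x v - dird g x v.
Proof.
by rewrite /dird -sumrB; apply: eq_bigr => i _; rewrite mderivB mevalB mulrBl.
Qed.

Lemma dirdZ n a (f : {mpoly C[n]}) x v : dird (a *: f) x v = a * dird f x v.
Proof.
by rewrite /dird mulr_sumr; apply: eq_bigr => i _; rewrite mderivZ mevalZ mulrA.
Qed.

Lemma dirdM n (f g : {mpoly C[n]}) x v :
  dird (f * g) x v = dird f x v * g.@[x ord0] + f.@[x ord0] * dird g x v.
Proof.
rewrite /dird mulr_suml mulr_sumr -big_split; apply: eq_bigr => i _ /=.
by rewrite mderivM mevalD !mevalM; ring.
Qed.

Lemma dird1 n x v : dird (1 : {mpoly C[n]}) x v = 0.
Proof. by rewrite /dird big1 // => i _; rewrite -mpolyC1 mderivC meval0 mul0r. Qed.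

Lemma dirdX n k x v : dird ('X_k : {mpoly C[n]}) x v = v 0 k.
Proof.
rewrite /dird (bigD1 k) //= big1 ?addr0 => [|i ik].
  rewrite mderivX mnm1E eqxx scale1r mevalX big1 ?mul1r // => j _.
  by rewrite mnmBE subnn expr0.
by rewrite mderivX mnm1E eq_sym (negPf ik) scale0r meval0 mul0r.
Qed.

Lemma dird_linr n (f : {mpoly C[n]}) x a u v :
  dird f x (a *: u + v) = a * dird f x u + dird f x v.
Proof.
rewrite /dird mulr_sumr -big_split; apply: eq_bigr => i _ /=.
by rewrite !mxE; ring.
Qed.

Lemma dird0r n (f : {mpoly C[n]}) x : dird f x 0 = 0.
Proof. by rewrite /dird big1 // => i _; rewrite mxE mulr0. Qed.

Lemma vanishing_lin n (X : set 'rV[C]_n) a f g :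
  vanishing_ideal X f -> vanishing_ideal X g -> vanishing_ideal X (a *: f + g).
Proof. by move=> If Ig x Xx; rewrite mevalD mevalZ If // Ig // mulr0 addr0. Qed.

Lemma vanishing0 n (X : set 'rV[C]_n) : vanishing_ideal X 0.
Proof. by move=> x _; rewrite meval0. Qed.

Lemma tangent_exists n (X : set 'rV[C]_n) x : exists W, is_tangent_space X x W.
Proof.
apply: (@subspace_vs _ n
  (fun v => forall f, vanishing_ideal X f -> dird f x v = 0)).
  by move=> f _; rewrite dird0r.
by move=> a u v Hu Hv f If; rewrite dird_linr Hu // Hv // mulr0 addr0.
Qed.

Lemma tangent_uniq n (X : set 'rV[C]_n) x W W' :
  is_tangent_space X x W -> is_tangent_space X x W' -> W = W'.
Proof.
move=> T T'; apply/vspaceP => v.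
by apply/idP/idP => [/(proj1 (T v))/(proj2 (T' v))|/(proj1 (T' v))/(proj2 (T v))].
Qed.

(** Gradients of equations of [X] form a subspace, spanned by the rows of [M];
    the tangent space is its orthogonal. *)
Lemma conormal_mx n (X : set 'rV[C]_n) x : exists M : 'M[C]_n,
  (forall u, (u <= M)%MS <-> exists2 f, vanishing_ideal X f & grad f x = u) /\
  (forall W, is_tangent_space X x W ->
     forall v, v \in W <-> M *m v^T = 0).
Proof.
have [||M MP] := @subspace_mx _ n
  (fun u => exists2 f, vanishing_ideal X f & grad f x = u).
- by exists 0; [exact: vanishing0 | exact: grad0].
- move=> a u v [f If <-] [g Ig <-]; exists (a *: f + g).
    exact: vanishing_lin.
  exact: grad_lin.
exists M; split=> // W TW v; split.
  move/(TW v) => H; apply/row_matrixP => i; rewrite row0 row_mul.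
  have /MP[f If <-] : (row i M <= M)%MS by exact: row_sub.
  by apply/rowP => j; rewrite ord1 grad_dird mxE; apply: H.
move=> Mv; apply/(TW v) => f If.
have /submxP[u gu] : (grad f x <= M)%MS by apply/MP; exists f.
by rewrite -[LHS]/(dird f x v) -grad_dird gu -mulmxA Mv mulmx0 mxE.
Qed.

(** By double orthogonality, equations of [X] with any prescribed gradient
    orthogonal to the tangent space exist. *)
Lemma conormal_bidual n (X : set 'rV[C]_n) x W (u : 'rV[C]_n) :
  is_tangent_space X x W -> (forall w, w \in W -> u *m w^T = 0) ->
  exists2 f, vanishing_ideal X f & grad f x = u.
Proof.
move=> TW uW; have [M [MP MW]] := conormal_mx X x.
by apply/MP/sub_biorthogonal => w /(MW _ TW)/uW.
Qed.

Lemma tangent_mul n (X : set 'rV[C]_n) x m (A : 'M[C]_(m, n)) f :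
  is_tangent_space X x (row_space A) -> vanishing_ideal X f ->
  grad f x *m A^T = 0.
Proof.
move=> TA If; apply/rowP => i; rewrite mxE [RHS]mxE.
have /TA/(_ f If) : row i A \in row_space A by rewrite mem_row_space row_sub.
by move=> /(etrans _); apply; apply: eq_bigr => j _; rewrite !mxE.
Qed.

Lemma dim_orthogonal n (W : {vspace 'rV[C]_n}) (M : 'M[C]_n) :
  (forall v, v \in W <-> M *m v^T = 0) -> (\dim W + \rank M = n)%N.
Proof.
move=> MW.
have -> : W = row_space (kermx M^T).
  apply/vspaceP => v; rewrite mem_row_space; apply/idP/idP.
    by move/MW => Mv; apply/sub_kermxP/trmx_inj; rewrite trmx_mul trmxK trmx0.
  move/sub_kermxP => vM; apply/MW/trmx_inj; by rewrite trmx_mul trmxK trmx0.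
by rewrite dim_row_space mxrank_ker mxrank_tr subnK // rank_leq_row.
Qed.

(** For [D] contained in [X], this is Zariski density of [D] in [X]. *)
Definition dense_in n (X D : set 'rV[C]_n) :=
  forall f : {mpoly C[n]}, (forall x, D x -> f.@[x ord0] = 0) -> vanishing_ideal X f.

Definition eval_mx n m p (F : 'M[{mpoly C[n]}]_(m, p)) (x : 'rV[C]_n) : 'M[C]_(m, p) :=
  map_mx (meval (x ord0)) F.

Definition grad_mx n (f : 'I_n -> {mpoly C[n]}) : 'M[{mpoly C[n]}]_n :=
  \matrix_(k, l) (f k)^`M(l).

Lemma row_grad_mx n (f : 'I_n -> {mpoly C[n]}) x k :
  row k (eval_mx (grad_mx f) x) = grad (f k) x.
Proof. by apply/rowP => i; rewrite !mxE. Qed.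

(** A tangent space of dimension less than [d] at [y] means that more than
    [n - d] equations of [X] have independent gradients at [y].  A minor of their
    Jacobian matrix is then nonzero at [y], although all minors of this size
    vanish on [D], hence on [X]. *)
Lemma tangent_semicontinuous n (X D : set 'rV[C]_n) d :
  dense_in X D ->
  (forall x W, D x -> is_tangent_space X x W -> (d <= \dim W)%N) ->
  forall y W, X y -> is_tangent_space X y W -> (d <= \dim W)%N.
Proof.
move=> dD dW y W Xy TW; rewrite leqNgt; apply/negP => Wd.
have [M [MP MW]] := conormal_mx X y.
have dimW := dim_orthogonal (MW W TW).
have /choice[f fP] k : exists f, vanishing_ideal X f /\ grad f y = row k M.
  by have /MP[g] := row_sub k M; exists g.
pose r : nat := \rank M.
(* [H] is the Jacobian matrix written in bases where its value at [y] is
   [pid_mx r], then completed by [copid_mx r]: its determinant plays the role of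
   the minor of size [r]. *)
pose L := col_ebase M; pose R := row_ebase M.
pose cm (A : 'M[C]_n) : 'M[{mpoly C[n]}]_n := map_mx (@mpolyC n C) A.
have cmE A x : eval_mx (cm A) x = A by apply/matrixP => k l; rewrite !mxE mevalC.
pose H : 'M[{mpoly C[n]}]_n := cm (invmx L) *m grad_mx f *m cm (invmx R) + cm (copid_mx r).
have HE x : eval_mx H x =
    invmx L *m eval_mx (grad_mx f) x *m invmx R + copid_mx r.
  rewrite /H /eval_mx map_mxD !map_mxM /=.
  by congr (_ *m _ *m _ + _); apply: cmE.
have detE (x : 'rV[C]_n) : (\det H).@[x ord0] = \det (eval_mx H x).
  by rewrite /eval_mx det_map_mx.
have Hy : eval_mx H y = 1%:M.
  rewrite HE (_ : eval_mx _ y = M).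
    rewrite -[X in _ *m X *m _](mulmx_ebase M) -/L -/R !mulmxA mulVmx ?col_ebase_unit // mul1mx.
    by rewrite mulmxK ?row_ebase_unit // /copid_mx addrC subrK.
  by apply/row_matrixP => k; rewrite row_grad_mx; case: (fP k).
suff /(_ y Xy) : vanishing_ideal X (\det H).
  by rewrite detE Hy det1 => /eqP; rewrite oner_eq0.
apply: dD => x Dx; rewrite detE; apply/eqP; apply: contraT.
rewrite -unitfE -[_ \is a _]/(eval_mx H x \in unitmx) -row_full_unit => /eqP full.
have [V TV] := tangent_exists X x.
have [N [NP NV]] := conormal_mx X x.
have dV := dW _ _ Dx TV.
have dimV := dim_orthogonal (NV _ TV).
have gN : (eval_mx (grad_mx f) x <= N)%MS.
  apply/row_subP => k; rewrite row_grad_mx; apply/NP; exists (f k) => //.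
  by case: (fP k).
have rle : (\rank (eval_mx H x) <= \rank N + (n - r))%N.
  rewrite HE; apply: leq_trans (mxrank_add _ _) _; apply: leq_add.
    apply: leq_trans (mxrankM_maxl _ _) _; apply: leq_trans (mxrankM_maxr _ _) _.
    exact: mxrankS.
  by rewrite rank_copid_mx // rank_leq_row.
by move: rle; rewrite full; move: dimW; rewrite -/r; lia.
Qed.

End Tangent.

(** * Equations of the charts of a Nash blowup *)

Section NashClosure.
Context {C : fieldType}.
Implicit Types (n : nat).

(** Clearing denominators: with [d] above the degree of [f], the function
    [q ^ d * f (P / q)] is a polynomial. *)
Lemma meval_frac k n (f : {mpoly C[k]}) (P : 'I_k -> {mpoly C[n]}) q :
  exists g d, forall x : 'I_n -> C, q.@[x] != 0 ->
    g.@[x] = q.@[x] ^+ d * f.@[fun t => (P t).@[x] / q.@[x]].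
Proof.
exists (\sum_(a <- msupp f)
          f@_a *: (\prod_t P t ^+ a t * q ^+ (msize f - mdeg a))), (msize f).
move=> x q0; rewrite [f.@[_]]mevalE mulr_sumr raddf_sum /= !big_seq.
apply: eq_bigr => a /msize_mdeg_lt/ltnW af.
have -> : \prod_i ((P i).@[x] / q.@[x]) ^+ a i =
    (\prod_i P i ^+ a i).@[x] / q.@[x] ^+ mdeg a.
  rewrite rmorph_prod /= mdegE -prodrXr -prodfV -big_split.
  by apply: eq_bigr => t _ /=; rewrite expr_div_n rmorphXn.
rewrite mevalZ mevalM rmorphXn /= -[in RHS](subnK af) exprD.
have aux (c p r s : C) : r != 0 -> c * (p * s) = s * r * (c * (p / r)).
  by move=> r0; field.
by apply: aux; rewrite expf_neq0.
Qed.

Definition chart_pt n (x : 'rV[C]_n) (B : 'M[C]_n) : 'rV[C]_(n + n * n) :=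
  row_mx x (mxvec B).

Lemma pt_chart_pt n (x : 'rV[C]_n) B : pt_coord (chart_pt x B) = x.
Proof. exact: row_mxKl. Qed.

Lemma mx_chart_pt n (x : 'rV[C]_n) B : mx_coord (chart_pt x B) = B.
Proof. by rewrite /mx_coord row_mxKr mxvecK. Qed.

Lemma chart_ptK n (y : 'rV[C]_(n + n * n)) : chart_pt (pt_coord y) (mx_coord y) = y.
Proof. by rewrite /chart_pt vec_mxK hsubmxK. Qed.

(** One polynomial [g] expresses that [q] vanishes or that [f] vanishes at the
    point of the Grassmannian chart with matrix [N / q]. *)
Lemma chart_pt_frac m n (f : {mpoly C[n + n * n]}) (xs : 'rV[{mpoly C[m]}]_n)
    (N : 'M[{mpoly C[m]}]_n) (q : {mpoly C[m]}) :
  exists g : {mpoly C[m]}, forall z : 'rV[C]_m,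
    (q.@[z ord0] = 0 -> g.@[z ord0] = 0) /\
    (q.@[z ord0] != 0 -> g.@[z ord0] = 0 <->
       f.@[chart_pt (eval_mx xs z) ((q.@[z ord0])^-1 *: eval_mx N z) ord0] = 0).
Proof.
pose P t := row_mx (q *: xs) (mxvec N) 0 t.
have [g [d gE]] := meval_frac f P q.
exists (q * g) => z; split=> [|qz]; first by rewrite mevalM => ->; rewrite mul0r.
rewrite mevalM gE //.
have -> : f.@[fun t => (P t).@[z ord0] / q.@[z ord0]] =
    f.@[chart_pt (eval_mx xs z) ((q.@[z ord0])^-1 *: eval_mx N z) ord0].
  apply: meval_eq => t; rewrite /P /chart_pt; case: (split_ordP t) => k ->.
    by rewrite !row_mxEl !mxE mevalM mulrC mulKf.
  by rewrite !row_mxEr; case/mxvec_indexP: k => a b; rewrite !mxvecE !mxE mulrC.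
split=> [/eqP|->]; last by rewrite !mulr0.
by rewrite !mulf_eq0 expf_eq0 (negPf qz) andbF => /eqP.
Qed.

Definition const_pmx m n p (A : 'M[C]_(m, n)) : 'M[{mpoly C[p]}]_(m, n) :=
  map_mx (@mpolyC p C) A.

Lemma eval_const_pmx m n p (A : 'M[C]_(m, n)) (x : 'rV[C]_p) : eval_mx (const_pmx p A) x = A.
Proof. by apply/matrixP => k l; rewrite !mxE mevalC. Qed.

Lemma eval_mxM m n p k (A : 'M[{mpoly C[k]}]_(m, n)) (B : 'M_(n, p)) x :
  eval_mx (A *m B) x = eval_mx A x *m eval_mx B x.
Proof. exact: map_mxM. Qed.

Lemma eval_mxD m n k (A B : 'M[{mpoly C[k]}]_(m, n)) x :
  eval_mx (A + B) x = eval_mx A x + eval_mx B x.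
Proof. exact: map_mxD. Qed.

Lemma eval_det n k (A : 'M[{mpoly C[k]}]_n) (x : 'rV[C]_k) :
  (\det A).@[x ord0] = \det (eval_mx A x).
Proof. by rewrite /eval_mx det_map_mx. Qed.

Lemma eval_adj n k (A : 'M[{mpoly C[k]}]_n) (x : 'rV[C]_k) :
  eval_mx (\adj A) x = \adj (eval_mx A x).
Proof. by rewrite /eval_mx map_mx_adj. Qed.

Lemma eval_row n (x : 'rV[C]_n) : eval_mx (\row_k 'X_k) x = x.
Proof. by apply/rowP => k; rewrite !mxE mevalXU. Qed.

Lemma vspace_mx n (W : {vspace 'rV[C]_n}) : exists A : 'M[C]_n, row_space A = W.
Proof.
have [||A AW] := @subspace_mx _ n (fun v => v \in W); first exact: mem0v.
  by move=> a u v uW vW; rewrite memvD ?memvZ.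
exists A; apply/vspaceP => v; rewrite mem_row_space.
by apply/idP/idP => /AW.
Qed.

(** Cramer's rule, in the form which shows that the solution is a quotient of
    polynomials in the entries. *)
Lemma adj_solve n (F : 'M[C]_n) m (A E : 'M[C]_(n, m)) :
  \det F != 0 -> F *m A = E -> (\det F)^-1 *: (\adj F *m E) = A.
Proof.
by move=> F0 <-; rewrite mulmxA mul_adj_mx mul_scalar_mx scalerA mulVf // scale1r.
Qed.

(** Near a smooth point [y] the normalized matrix of the tangent space is a
    rational function of the point: [n - #|J|] equations of [X] with independent
    gradients at [y] cut out the tangent space wherever a certain determinant
    does not vanish.  So [f], evaluated on this rational function and freed of
    denominators, is a polynomial which vanishes on [D], hence at [y]. *)
Lemma gauss_graph_closure n (X D : set 'rV[C]_n) (J : {set 'I_n})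
    (f : {mpoly C[n + n * n]}) :
  dense_in X D ->
  (forall x W, D x -> is_tangent_space X x W -> \dim W = #|J|) ->
  (forall x B, D x -> normalized J B -> is_tangent_space X x (row_space B) ->
     f.@[chart_pt x B ord0] = 0) ->
  forall y B, X y -> normalized J B -> is_tangent_space X y (row_space B) ->
     f.@[chart_pt y B ord0] = 0.
Proof.
move=> dD dimD fD y B Xy nB TB; set E := @coord_proj C n J.
have [EB BE] : E *m B = B /\ B *m E = E by apply/normalizedP.
have BB : B *m B = B by rewrite -{2}EB mulmxA BE.
have EtE : E^T = E by exact: coord_proj_tr.
have EE : E *m E = E by exact: coord_proj_idem.
have EBt : E *m B^T = E by rewrite -EtE -trmx_mul BE.
have BtE : B^T *m E = B^T by rewrite -EtE -trmx_mul EB.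
have BBt : B^T *m B^T = B^T by rewrite -trmx_mul BB.
(* The rows of [1 - B^T] with index outside [J] form a basis of the conormal
   space at [y]; those with index in [J] are zero. *)
have /choice[h hP] k : exists g, [/\ vanishing_ideal X g,
    grad g y = row k (1%:M - B^T) & k \in J -> g = 0].
  case: (boolP (k \in J)) => kJ.
    exists 0; split; rewrite ?grad0 //; first exact: vanishing0.
    have : E *m (1%:M - B^T) = 0 by rewrite mulmxBr mulmx1 EBt subrr.
    move=> H; apply/rowP => l; have /matrixP/(_ k l) := H.
    by rewrite coord_proj_mul kJ mulr1n !mxE.
  have [|g Ig gE] := @conormal_bidual _ _ X y _ (row k (1%:M - B^T)) TB.
    move=> w; rewrite mem_row_space => /submxP[u ->].
    by rewrite -row_mul trmx_mul mulmxA mulmxBl mul1mx BBt subrr mul0mx row0.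
  by exists g; split.
(* If [A] is the normalized matrix of the tangent space at [x], then
   [F(x) * A^T = E], which determines [A] when [F(x)] is invertible. *)
pose G := grad_mx h; pose F := G + const_pmx n E.
have FE x : eval_mx F x = eval_mx G x + E by rewrite eval_mxD eval_const_pmx.
have EG x : E *m eval_mx G x = 0.
  apply/matrixP => k l; rewrite coord_proj_mul.
  case: (boolP (k \in J)) => kJ; rewrite ?mulr0n ?mulr1n !mxE //.
  by case: (hP k) => _ _ /(_ kJ)->; rewrite mderiv0 meval0.
have EF x : E *m eval_mx F x = E by rewrite FE mulmxDr EG EE add0r.
have Fy : eval_mx F y = 1%:M - B^T + E.
  rewrite FE; congr (_ + _); apply/row_matrixP => k; rewrite row_grad_mx.
  by case: (hP k).
have FyU : eval_mx F y \in unitmx.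
  suff /mulmx1_unit[] : eval_mx F y *m (1%:M + B^T - E) = 1%:M by [].
  rewrite Fy !(mulmxDl, mulmxDr, mulmxN, mulNmx, mulmx1, mul1mx).
  rewrite BBt EE EBt BtE; apply/matrixP => a b; rewrite !mxE; ring.
have FyB : eval_mx F y *m B^T = E.
  by rewrite Fy mulmxDl mulmxBl mul1mx BBt EBt subrr add0r.
have [g gP] := chart_pt_frac f (\row_k 'X_k) (\adj F *m const_pmx n E)^T (\det F).
have key x A : eval_mx F x \in unitmx -> eval_mx F x *m A^T = E ->
    (g.@[x ord0] = 0 <-> f.@[chart_pt x A ord0] = 0).
  move=> Fx FA; have [_] := gP x; rewrite eval_det eval_row.
  rewrite unitmxE unitfE in Fx => /(_ Fx).
  rewrite (_ : eval_mx _^T x = (\adj (eval_mx F x) *m E)^T); last first.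
    by rewrite -[RHS]/((_ *m _)^T) -eval_adj -[in RHS](eval_const_pmx E x) -eval_mxM /eval_mx map_trmx.
  rewrite (_ : _ *: _^T = A) //; apply: trmx_inj.
  by rewrite linearZ /= trmxK; apply: adj_solve.
apply/(key y B FyU FyB); apply: dD Xy => x Dx.
have [Fx|] := boolP (eval_mx F x \in unitmx); last first.
  by rewrite unitmxE unitfE negbK -eval_det => /eqP /(proj1 (gP x)).
pose A := (invmx (eval_mx F x) *m E)^T.
have FA : eval_mx F x *m A^T = E by rewrite trmxK mulKVmx.
apply/(key x A Fx FA).
have [W TW] := tangent_exists X x.
have [T WT] := vspace_mx W; rewrite -WT in TW.
have nA : normalized J A.
  apply/normalizedP; rewrite -/E; split; apply: trmx_inj; rewrite trmx_mul EtE.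
    by rewrite trmxK -mulmxA EE.
  by rewrite -{1}(EF x) -mulmxA FA EE.
have TA : T = T *m A.
  apply: trmx_inj; rewrite trmx_mul trmxK -mulmxA.
  rewrite -[E *m _](_ : eval_mx F x *m T^T = _) ?mulKmx //.
  rewrite FE mulmxDl -[RHS]add0r; congr (_ + _).
  apply/row_matrixP => k; rewrite row_mul row_grad_mx row0.
  by apply: tangent_mul TW _; case: (hP k).
apply: (fD _ _ Dx nA).
rewrite (_ : row_space A = row_space T) //; apply/esym/row_space_eqmx/eqmxP.
have TsA : (T <= A)%MS by rewrite TA submxMl.
rewrite TsA -(geq_leqif (mxrank_leqif_sup TsA)) (rank_normalized nA).
by rewrite -dim_row_space (dimD _ _ Dx TW) leqnn.
Qed.

(** A subspace with [J']-normalized matrix [B'] lies in the chart of [J] when a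
    determinant in [B'] does not vanish, and then its [J]-normalized matrix is a
    rational function of [B'].  The condition on [f] thus becomes polynomial in
    [B'], and is vacuous outside the chart of [J]. *)
Lemma chart_closed n (J J' : {set 'I_n}) (f : {mpoly C[n + n * n]}) :
  #|J'| = #|J| ->
  zariski_closed (gr_chart J' (fun p => \dim p.2 = #|J| /\
    forall B, normalized J B -> row_space B = p.2 -> f.@[chart_pt p.1 B ord0] = 0)).
Proof.
move=> cJ; set E := @coord_proj C n J; set E' := @coord_proj C n J'.
have EE : E *m E = E by exact: coord_proj_idem.
have [P [P' [EP P'P]]] : exists P P' : 'M[C]_n, E *m P = P /\ P' *m P = E'.
  have [U [UU UE]] := @coord_proj_split C n J.
  have [U' [UU' UE']] : exists U' : 'M[C]_(n, #|J|),
      U'^T *m U' = 1%:M /\ U' *m U'^T = E'.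
    by rewrite -cJ; exact: coord_proj_split.
  exists (U *m U'^T), (U' *m U^T); split.
    by rewrite /E -UE mulmxA -(mulmxA U) UU mulmx1.
  by rewrite mulmxA -(mulmxA U') UU mulmx1.
(* [P] moves the rows with index in [J'] to the positions in [J], and [P']
   moves them back. *)
pose gen : 'rV[{mpoly C[n + n * n]}]_(n + n * n) := \row_k 'X_k.
pose Y : 'M[{mpoly C[n + n * n]}]_n := vec_mx (rsubmx gen).
have YE z : eval_mx Y z = mx_coord z.
  rewrite -{2}(eval_row z); apply/matrixP => a b; rewrite !mxE //.
have xE z : eval_mx (lsubmx gen) z = pt_coord z.
  by rewrite -{2}(eval_row z); apply/rowP => a; rewrite !mxE.
(* A [J]-normalized matrix with the row space of [P * Y] is a solution [A] of
   [H * A = P * Y]. *)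
pose H := const_pmx _ P *m Y *m const_pmx _ E + const_pmx _ (1%:M - E).
have HE z : eval_mx H z = P *m mx_coord z *m E + (1%:M - E).
  by rewrite /H eval_mxD !eval_mxM !eval_const_pmx YE.
have [g gP] := chart_pt_frac f (lsubmx gen) (\adj H *m (const_pmx _ P *m Y)) (\det H).
have key z A : eval_mx H z \in unitmx -> eval_mx H z *m A = P *m mx_coord z ->
    (g.@[z ord0] = 0 <-> f.@[chart_pt (pt_coord z) A ord0] = 0).
  move=> Hz HA; have [_] := gP z; rewrite eval_det xE.
  rewrite unitmxE unitfE in Hz => /(_ Hz).
  by rewrite !eval_mxM eval_adj eval_const_pmx YE (adj_solve Hz HA).
exists (fun h => (exists k l, k \notin J' /\ h = Y k l) \/
  (exists k l, [/\ k \in J', l \in J' & h = Y k l - ((k == l)%:R)%:MP]) \/ h = g).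
have Yev (z : 'rV[C]_(n + n * n)) k l : (Y k l).@[z ord0] = mx_coord z k l by rewrite -YE !mxE.
apply/predeqP => z; split.
  case=> nz [_ fz] h [[k [l [kJ ->]]]|[[k [l [kJ lJ ->]]]|->]].
  - by rewrite Yev (proj1 (nz k l)).
  - by rewrite mevalB mevalC Yev (proj2 (nz k l)) // subrr.
  have [Hz|] := boolP (eval_mx H z \in unitmx); last first.
    by rewrite unitmxE unitfE negbK -eval_det => /eqP /(proj1 (gP z)).
  pose A := invmx (eval_mx H z) *m (P *m mx_coord z).
  have HA : eval_mx H z *m A = P *m mx_coord z by rewrite mulKVmx.
  apply/(key z A Hz HA).
  have [E'z _] : E' *m mx_coord z = mx_coord z /\ mx_coord z *m E' = E'.
    by apply/normalizedP.
  have EP0 : (1%:M - E) *m P = 0 by rewrite mulmxBl mul1mx EP subrr.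
  have EH : (1%:M - E) *m eval_mx H z = 1%:M - E.
    rewrite HE mulmxDr !mulmxA EP0 !mul0mx add0r.
    by rewrite mulmxBr mulmx1 mulmxBl mul1mx EE subrr subr0.
  apply: fz.
    apply/normalizedP; rewrite -/E; split.
      have : (1%:M - E) *m A = 0.
        by rewrite -EH -mulmxA HA mulmxA EP0 mul0mx.
      by rewrite mulmxBl mul1mx => /eqP; rewrite subr_eq0 eq_sym => /eqP.
    rewrite -[LHS](mulKmx Hz) (mulmxA _ A) HA -[RHS](mulKmx Hz); congr (_ *m _).
    by rewrite HE mulmxDl -(mulmxA _ E E) EE mulmxBl mul1mx EE subrr addr0.
  apply: row_space_eqmx; apply/eqmxP/andP; split.
    by apply/submxP; exists (invmx (eval_mx H z) *m P); rewrite /= -mulmxA.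
  apply/submxP; exists (P' *m eval_mx H z).
  by rewrite -mulmxA HA mulmxA P'P E'z.
move=> zI; have nz : normalized J' (mx_coord z).
  move=> k l; split=> [kJ|kJ lJ].
    by rewrite -Yev; apply: zI; left; exists k, l.
  apply/eqP; rewrite -subr_eq0 -Yev -(mevalC (z ord0) (k == l)%:R) -mevalB.
  by apply/eqP/zI; right; left; exists k, l.
have [E'z _] : E' *m mx_coord z = mx_coord z /\ mx_coord z *m E' = E'.
  by apply/normalizedP.
split=> //; split; first by rewrite /= dim_row_space (rank_normalized nz).
move=> A nA /= rA.
have [EA AE] : E *m A = A /\ A *m E = E by apply/normalizedP.
have [K zK] : exists K, mx_coord z = K *m A.
  apply/submxP/row_subP => k; rewrite -mem_row_space rA mem_row_space.
  exact: row_sub.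
have [K' AK] : exists K, A = K *m (P *m mx_coord z).
  apply/submxP; apply: (@submx_trans _ _ _ _ _ _ (mx_coord z)).
    by apply/row_subP => k; rewrite -mem_row_space -rA mem_row_space row_sub.
  by rewrite -{1}E'z -P'P -mulmxA submxMl.
have HA : eval_mx H z *m A = P *m mx_coord z.
  rewrite HE mulmxDl mulmxBl mul1mx EA subrr addr0 -mulmxA EA -mulmxA; congr (_ *m _).
  by rewrite {1}zK -mulmxA -{2}EA (mulmxA A) AE EA -zK.
have Hz : eval_mx H z \in unitmx.
  suff /mulmx1_unit[] : (E *m K' *m E + (1%:M - E)) *m eval_mx H z = 1%:M by [].
  have EPz : E *m (P *m mx_coord z) = P *m mx_coord z by rewrite mulmxA EP.
  have e1 : E *m K' *m E *m (P *m mx_coord z *m E) = E.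
    by rewrite -!(mulmxA E) -(mulmxA K') (mulmxA E (P *m _)) EPz (mulmxA K') -AK AE.
  have e2 : E *m (1%:M - E) = 0 by rewrite mulmxBr mulmx1 EE subrr.
  have e3 : (1%:M - E) *m (P *m mx_coord z *m E) = 0.
    by rewrite mulmxBl mul1mx (mulmxA E) EPz subrr.
  have e4 : (1%:M - E) *m (1%:M - E) = 1%:M - E.
    by rewrite mulmxBr mulmx1 mulmxBl mul1mx EE subrr subr0.
  rewrite HE mulmxDl (mulmxDr (E *m K' *m E)) (mulmxDr (1%:M - E)) e1 e3 e4 -(mulmxA _ E) e2 mulmx0 addr0 add0r.
  by rewrite addrC subrK.
by apply/(key z A Hz HA); apply: zI; right; right.
Qed.

(** The set of pairs [(x, W)] such that [f] vanishes at [(x, W)] if [W] is in the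
    chart of [J] is closed in all charts and contains the graph of the Gauss
    map; so it contains the Nash blowup. *)
Lemma nash_chart_closure n (X D : set 'rV[C]_n) (J : {set 'I_n})
    (f : {mpoly C[n + n * n]}) :
  dense_in X D -> #|J| = dimension X ->
  (forall x W, D x -> is_tangent_space X x W -> \dim W = dimension X) ->
  (forall x B, D x -> normalized J B -> is_tangent_space X x (row_space B) ->
     f.@[chart_pt x B ord0] = 0) ->
  vanishing_ideal (gr_chart J (affine_nash X)) f.
Proof.
move=> dD cJ dimD fD y [ny [_ [_ cl]]].
pose Z (p : 'rV[C]_n * {vspace 'rV[C]_n}) := \dim p.2 = #|J| /\
    forall B, normalized J B -> row_space B = p.2 -> f.@[chart_pt p.1 B ord0] = 0.
have [||_] := cl Z.
- split=> [p []|J' cJ']; first by rewrite cJ.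
  by apply: chart_closed; rewrite cJ' cJ.
- case=> x W [[/= Xx [W' [TW' dW']]] /= TW]; split=> /=.
    by rewrite (tangent_uniq TW TW') dW' cJ.
  move=> B nB WB; rewrite -WB in TW.
  by apply: (gauss_graph_closure dD _ fD Xx nB TW) => x' W'' Dx TW''; rewrite cJ (dimD _ _ Dx TW'').
by move=> /(_ _ ny erefl); rewrite /= chart_ptK.
Qed.

End NashClosure.

(** * Characters of the lattice and Laurent polynomials *)

Definition det2 (a b : int * int) : int := a.1 * b.2 - a.2 * b.1.

Lemma fstD (a b : int * int) : (a + b).1 = a.1 + b.1. Proof. by []. Qed.
Lemma sndD (a b : int * int) : (a + b).2 = a.2 + b.2. Proof. by []. Qed.

Lemma Z2P (a b : int * int) : a.1 = b.1 -> a.2 = b.2 -> a = b.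
Proof. by case: a b => x y [x' y'] /= -> ->. Qed.
Lemma fstMn (a : int * int) k : (a *+ k).1 = a.1 * k%:Z.
Proof. by elim: k => [|k IHk]; rewrite ?mulr0n ?mulr0 // mulrS fstD IHk; lia. Qed.
Lemma sndMn (a : int * int) k : (a *+ k).2 = a.2 * k%:Z.
Proof. by elim: k => [|k IHk]; rewrite ?mulr0n ?mulr0 // mulrS sndD IHk; lia. Qed.

Section Characters.
Context {C : numFieldType}.

(** Points of the torus are taken to be the homomorphisms from Z^2 to the
    nonzero scalars, so that no basis of the lattice has to be chosen: the
    natural basis changes from chart to chart. *)
Definition is_char (chi : int * int -> C) :=
  chi 0 = 1 /\ forall a b, chi (a + b) = chi a * chi b.

Lemma char_neq0 chi a : is_char chi -> chi a != 0.
Proof.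
case=> c1 cM; apply/eqP => ca; have /eqP := c1.
by rewrite -(subrr a) cM ca mul0r eq_sym oner_eq0.
Qed.

Lemma charMn chi a k : is_char chi -> chi (a *+ k) = chi a ^+ k.
Proof.
case=> c1 cM; elim: k => [|k IHk]; first by rewrite mulr0n c1.
by rewrite mulrS cM IHk exprS.
Qed.

Lemma char_sum chi I (r : seq I) (F : I -> int * int) : is_char chi ->
  chi (\sum_(i <- r) F i) = \prod_(i <- r) chi (F i).
Proof. by case=> c1 cM; apply: (big_morph chi cM c1). Qed.

Lemma charX chi k : is_char chi -> is_char (fun a => chi a ^+ k).
Proof. by case=> c1 cM; split=> [|a b]; rewrite ?c1 ?expr1n // cM exprMn. Qed.

(** By unique factorization this single character separates the points of Z^2.
    Its powers are all the points of the torus needed to detect that a Laurent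
    polynomial is zero. *)
Definition char23 (a : int * int) : C := 2%:R ^ a.1 * 3%:R ^ a.2.

Lemma char23_char : is_char char23.
Proof.
split; first by rewrite /char23 !expr0z mulr1.
by move=> a b; rewrite /char23 !expfzDr ?pnatr_eq0 // mulrACA.
Qed.

Lemma eq_exp23 p q : (2 ^ p = 3 ^ q -> p = 0 /\ q = 0)%N.
Proof.
move=> e; have : odd (2 ^ p) = odd (3 ^ q) by rewrite e.
rewrite !oddX orbT orbF => /eqP p0; split=> //; move: e; rewrite p0.
case: q => // q; rewrite expn0 expnS; lia.
Qed.

Lemma char23_inj : injective char23.
Proof.
have two0 : (2%:R : C) != 0 by rewrite pnatr_eq0.
have three0 : (3%:R : C) != 0 by rewrite pnatr_eq0.
suff ker a : char23 a = 1 -> a = 0.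
  move=> a b ab; apply/eqP; rewrite -subr_eq0; apply/eqP/ker.
  have cc := char23_char; apply: (mulIf (char_neq0 b cc)).
  by rewrite mul1r -(proj2 cc) subrK.
case: a => x y; rewrite /char23 /=.
have mulE p q : (2%:R : C) ^+ p * 3%:R ^+ q = 1 -> p = 0%N /\ q = 0%N.
  rewrite -!natrX -natrM => /eqP; rewrite -[1]/(1%:R) eqr_nat muln_eq1.
  by case: p => [|p]; case: q => [|q] //; rewrite !expnS; lia.
have divE p q : (2%:R : C) ^+ p = 3%:R ^+ q -> p = 0%N /\ q = 0%N.
  by rewrite -!natrX => /eqP; rewrite eqr_nat => /eqP/eq_exp23.
case: (intP x) => [|p|p]; case: (intP y) => [|q|q] //; rewrite -?exprnN -?exprnP;
  rewrite ?expr0z ?mul1r ?mulr1 //.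
- by move=> e; have [] := mulE 0%N q.+1 _; rewrite ?expr0 ?mul1r.
- move/eqP; rewrite invr_eq1 => /eqP e.
  by have [] := mulE 0%N q.+1 _; rewrite ?expr0 ?mul1r.
- by move=> e; have [] := mulE p.+1 0%N _; rewrite ?expr0 ?mulr1.
- by move=> e; have [] := mulE p.+1 q.+1 e.
- by move/divr1_eq => e; have [] := divE p.+1 q.+1 e.
- move/eqP; rewrite invr_eq1 => /eqP e.
  by have [] := mulE p.+1 0%N _; rewrite ?expr0 ?mulr1.
- by rewrite mulrC => /divr1_eq/esym e; have [] := divE p.+1 q.+1 e.
- move/eqP; rewrite -invfM invr_eq1 => /eqP e.
  by have [] := mulE p.+1 q.+1 e.
Qed.

Lemma interpolate (T : eqType) (h g : T -> C) (s : seq T) : injective h ->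
  exists P : {poly C}, forall m, m \in s -> P.[h m] = g m.
Proof.
move=> hI; elim: s => [|x s [P HP]]; first by exists 0.
have [xs|xs] := boolP (x \in s).
  by exists P => m; rewrite in_cons => /orP[/eqP->|]; exact: HP.
pose Q := \prod_(z <- s) ('X - (h z)%:P).
have Qx : Q.[h x] != 0.
  rewrite horner_prod prodf_seq_neq0; apply/allP => z zs /=.
  rewrite !hornerE subr_eq0 (inj_eq hI).
  by apply: contraNneq xs => ->.
exists (P + ((g x - P.[h x]) / Q.[h x]) *: Q) => m.
rewrite in_cons !hornerE => /orP[/eqP->|ms]; first by rewrite divfK // addrC subrK.
suff -> : Q.[h m] = 0 by rewrite mulr0 addr0 HP.
rewrite horner_prod; apply/eqP; rewrite prodf_seq_eq0; apply/hasP; exists m => //.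
by rewrite !hornerE subrr eqxx.
Qed.

(** Linear independence of the monomials, stated so that a vanishing combination
    of monomials remains zero when they are replaced by the values of
    any function of the exponent.  Evaluation at the powers of [char23] gives
    the statement for [g = P \o char23] with [P] a polynomial, and [P] can be
    chosen to interpolate. *)
Lemma char_indep I (r : seq I) (b : I -> C) (m : I -> int * int) :
  (forall chi, is_char chi -> \sum_(i <- r) b i * chi (m i) = 0) ->
  forall g, \sum_(i <- r) b i * g (m i) = 0.
Proof.
move=> H g; have [P HP] := interpolate g [seq m i | i <- r] char23_inj.
transitivity (\sum_(i <- r) b i * P.[char23 (m i)]).
  elim: r P HP {H} => [|i r IHr] P HP; rewrite ?big_nil // !big_cons HP.
    congr (_ + _); apply: IHr => x xr.
    by apply: HP; rewrite /= in_cons xr orbT.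
  by rewrite /= in_cons eqxx.
under eq_bigr => i _ do rewrite horner_coef mulr_sumr.
rewrite exchange_big big1 //= => j _.
under eq_bigr => i _ do rewrite mulrCA.
by rewrite -mulr_sumr (H (fun a => char23 a ^+ j)) ?mulr0 //; apply/charX/char23_char.
Qed.

Section Laurent.
(** Laurent polynomials, as functions on the torus, with exponents in the square
    of radius [h]; the radius is what the dimension count below keeps track
    of. *)
Definition laurent (h : nat) (phi : (int * int -> C) -> C) :=
  exists2 r : seq (C * (int * int)),
    (forall x, x \in r -> (`|x.2.1| <= h%:Z) && (`|x.2.2| <= h%:Z)) &
    forall chi, is_char chi -> phi chi = \sum_(x <- r) x.1 * chi x.2.

Lemma laurentW h h' phi : (h <= h')%N -> laurent h phi -> laurent h' phi.
Proof. by move=> hh [r rh E]; exists r => // x /rh; lia. Qed.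

Lemma laurent_ext h phi psi : (forall chi, is_char chi -> phi chi = psi chi) ->
  laurent h phi -> laurent h psi.
Proof. by move=> E [r rh rE]; exists r => // chi cc; rewrite -E // rE. Qed.

Lemma laurent1 : laurent 0 (fun=> 1).
Proof.
exists [:: (1, (0, 0))] => [x|chi [c1 _]].
  by rewrite inE => /eqP->; rewrite normr0.
by rewrite big_seq1 /= mul1r c1.
Qed.

Lemma laurentM h h' phi psi : laurent h phi -> laurent h' psi ->
  laurent (h + h') (fun chi => phi chi * psi chi).
Proof.
move=> [r rh rE] [s sh sE].
exists [seq (x.1 * y.1, x.2 + y.2) | x <- r, y <- s].
  move=> z /allpairsP[[x y] /= [/rh /andP[x1 x2] /sh /andP[y1 y2] ->]] /=.
  by rewrite PoszD !(le_trans (ler_normD _ _)) ?lerD.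
move=> chi cc; rewrite rE // sE // big_allpairs_dep mulr_suml.
apply: eq_bigr => x _; rewrite mulr_sumr; apply: eq_bigr => y _ /=.
by rewrite (proj2 cc); ring.
Qed.

Lemma laurentX h phi k : laurent h phi -> laurent (k * h) (fun chi => phi chi ^+ k).
Proof.
move=> L; elim: k => [|k IHk]; first exact: laurent1.
by rewrite mulSn; apply: laurent_ext (laurentM L IHk) => chi _; rewrite exprS.
Qed.

Lemma laurent_prod I (s : seq I) (h : I -> nat) (phi : I -> (int * int -> C) -> C) :
  (forall i, laurent (h i) (phi i)) ->
  laurent (\sum_(i <- s) h i) (fun chi => \prod_(i <- s) phi i chi).
Proof.
move=> L; elim: s => [|i s IHs]; rewrite ?big_nil ?big_cons.
  by apply: laurent_ext laurent1 => chi _; rewrite big_nil.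
by apply: laurent_ext (laurentM (L i) IHs) => chi _; rewrite big_cons.
Qed.

Definition box h (t : 'I_(h.*2.+1) * 'I_(h.*2.+1)) : int * int :=
  (t.1%:Z - h%:Z, t.2%:Z - h%:Z).

Lemma box_inj h : injective (@box h).
Proof.
move=> [i j] [i' j'] [] e1 e2; congr (_, _); apply/val_inj => /=; lia.
Qed.

Lemma box_surj h (m : int * int) :
  (`|m.1| <= h%:Z) && (`|m.2| <= h%:Z) -> exists t, m = @box h t.
Proof.
case: m => x y /= xy.
have xl : (absz (x + h%:Z)%R < h.*2.+1)%N by lia.
have yl : (absz (y + h%:Z)%R < h.*2.+1)%N by lia.
exists (Ordinal xl, Ordinal yl); rewrite /box /=; congr (_, _); lia.
Qed.

Lemma laurent_box h phi : laurent h phi ->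
  exists w, forall chi, is_char chi -> phi chi = \sum_t w t * chi (@box h t).
Proof.
move=> [r rh rE].
exists (fun t => \sum_(x <- r) x.1 *+ (x.2 == box t)) => chi cc; rewrite rE //.
under [RHS]eq_bigr => t _ do rewrite mulr_suml.
rewrite exchange_big !big_seq; apply: eq_bigr => x /rh xh /=.
have [t0 xE] := box_surj xh.
rewrite (bigD1 t0) //= xE eqxx big1 ?addr0 // => t tn.
by rewrite (inj_eq (@box_inj h)) eq_sym (negPf tn) mul0r.
Qed.

(** A dimension count: the monomials in the [phi i] with exponents below [N] are
    [N ^ e] in number, and they lie in a space of Laurent polynomials whose
    dimension grows like [N ^ 2]. *)
Lemma laurent_dep e (phi : 'I_e -> (int * int -> C) -> C) :
  (2 < e)%N -> (forall i, exists h, laurent h (phi i)) ->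
  exists2 P : {mpoly C[e]}, P != 0 &
    forall chi, is_char chi -> P.@[fun i => phi i chi] = 0.
Proof.
move=> e2 /choice[h hP].
(* The dimension is at most [(2 H N + 1) ^ 2 <= K ^ 2 * N ^ 2 < N ^ 3]. *)
pose H := (\sum_i h i)%N; pose K := (H.*2.+1)%N; pose N := (K ^ 2).+1.
pose T := {ffun 'I_e -> 'I_N}.
have L (a : T) : laurent (H * N) (fun chi => \prod_i phi i chi ^+ a i).
  apply: laurentW (laurent_prod _ (fun i => laurentX (a i) (hP i))).
  rewrite big_distrl /=; apply: leq_sum => i _; rewrite mulnC leq_mul2l ltnW ?orbT //.
have /choice[w wE] a := laurent_box (L a).
pose M : 'M[C]_(#|T|, #|{: 'I_((H * N).*2.+1) * 'I_((H * N).*2.+1)}|) :=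
  \matrix_(a, t) w (enum_val a) (enum_val t).
have [u uM u0] : exists2 u : 'rV[C]_#|T|, u *m M = 0 & u != 0.
  have kM : kermx M != 0.
    rewrite -mxrank_eq0 mxrank_ker subn_eq0 -ltnNge.
    apply: leq_ltn_trans (rank_leq_col _) _.
    rewrite card_prod card_ffun !card_ord.
    apply: (@leq_ltn_trans (K ^ 2 * N ^ 2)).
      rewrite -expnMn -mulnn leq_mul //; rewrite /K; nia.
    apply: (@leq_trans (N ^ 3)); last by rewrite leq_exp2l.
    by rewrite [in X in (_ < X)%N]expnS ltn_pmul2r ?expn_gt0.
  by have /rowV0Pn[u /sub_kermxP uM u0] := kM; exists u.
pose mon (a : T) : 'X_{1..e} := [multinom (a i : nat) | i < e].
have monI : injective mon.
  move=> a b /mnmP ab; apply/ffunP => i; apply/val_inj.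
  by have := ab i; rewrite !mnmE.
exists (\sum_a u 0 a *: 'X_[mon (enum_val a)]).
  apply: contraNneq u0 => P0; apply/eqP/rowP => a; rewrite mxE.
  have /(congr1 (mcoeff (mon (enum_val a)))) := P0.
  rewrite raddf_sum mcoeff0 (bigD1 a) //= mcoeffZ mcoeffX eqxx mulr1.
  rewrite big1 ?addr0 // => b ba; rewrite mcoeffZ mcoeffX.
  by rewrite (inj_eq monI) (inj_eq enum_val_inj) (negPf ba) mulr0.
move=> chi cc; rewrite raddf_sum /=.
transitivity (\sum_a u 0 a * \sum_t w (enum_val a) t * chi (box t)).
  apply: eq_bigr => a _; rewrite mevalZ mevalX -wE //; congr (_ * _).
  by apply: eq_bigr => i _; rewrite mnmE.
under eq_bigr => a _ do rewrite mulr_sumr.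
rewrite exchange_big big1 //= => t _.
under eq_bigr => a _ do rewrite mulrA.
rewrite -mulr_suml.
have /rowP/(_ (enum_rank t)) := uM; rewrite !mxE => uMt.
rewrite (_ : \sum_i _ = 0) ?mul0r // -[RHS]uMt.
by apply: eq_bigr => a _; rewrite mxE enum_rankK.
Qed.

End Laurent.
End Characters.

(** * Torus parametrizations and their tangent spaces *)

Lemma int_split (z : int) : exists a b : nat, z = a%:Z - b%:Z.
Proof.
case: z => n; first by exists n, 0%N; rewrite subr0.
by exists 0%N, n.+1; rewrite sub0r NegzE.
Qed.

Section Toric.
Context {C : numFieldType}.
Implicit Types (n : nat).

Section Param.
Variables (n : nat) (delta : 'I_n -> int * int) (c : 'I_n -> C).

Definition torus_pt (chi : int * int -> C) : 'rV[C]_n := \row_k (c k * chi (delta k)).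

Definition torus : set 'rV[C]_n := fun x => exists2 chi, is_char chi & x = torus_pt chi.

Definition mdegZ (a : 'X_{1..n}) : int * int := \sum_k delta k *+ a k.

Lemma meval_torus_pt chi (f : {mpoly C[n]}) : is_char chi ->
  f.@[torus_pt chi ord0] =
  \sum_(a <- msupp f) (f@_a * \prod_k c k ^+ a k) * chi (mdegZ a).
Proof.
move=> cc; rewrite mevalE; apply: eq_bigr => a _; rewrite -mulrA; congr (_ * _).
rewrite char_sum // -big_split; apply: eq_bigr => k _ /=.
by rewrite mxE exprMn charMn //.
Qed.

(** Euler's formula: the vector field [x_k lam_k] has the monomial [x ^ a] as an
    eigenvector, with eigenvalue [\sum_k a_k lam_k]. *)
Lemma dird_euler (f : {mpoly C[n]}) (x : 'rV[C]_n) (lam : 'I_n -> C) :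
  dird f x (\row_k (x 0 k * lam k)) =
  \sum_(a <- msupp f) f@_a * (\prod_k x 0 k ^+ a k) * \sum_k lam k *+ a k.
Proof.
have dE k : (f^`M(k)).@[x ord0] =
    \sum_(a <- msupp f) ((f@_a *: 'X_[a])^`M(k)).@[x ord0].
  by rewrite {1}(mpolyE f) (raddf_sum (mderiv k)) (raddf_sum (meval _)).
rewrite /dird; under eq_bigr => k _ do rewrite dE mulr_suml.
rewrite exchange_big; apply: eq_bigr => a _ /=; rewrite mulr_sumr.
apply: eq_bigr => k _; rewrite mxE mderivZ mderivX !mevalZ mevalX -mulr_natr.
case: (posnP (a k)) => [->|ak]; first by rewrite !(mulr0n, mulr0, mul0r).
rewrite (bigD1 k) //= [in RHS](bigD1 k) //= mnmBE mnm1E eqxx subn1.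
rewrite (eq_bigr (fun i => x 0 i ^+ a i)) => [|i ik]; last first.
  by rewrite mnmBE mnm1E eq_sym (negPf ik) subn0.
have -> : x 0 k ^+ a k = x 0 k * x 0 k ^+ (a k).-1 by rewrite -exprS prednK.
by ring.
Qed.

(** [g] restricts to the monomial of exponent [m] on the torus.  Constants [c]
    being absorbed, such [g] multiply when exponents add. *)
Definition represents (g : {mpoly C[n]}) (m : int * int) :=
  forall chi, is_char chi -> g.@[torus_pt chi ord0] = chi m.

Lemma represents0 : represents 1 0.
Proof. by move=> chi [c1 _]; rewrite meval1. Qed.

Lemma representsD g h a b : represents g a -> represents h b -> represents (g * h) (a + b).
Proof. by move=> ga hb chi cc; rewrite mevalM ga // hb // (proj2 cc). Qed.

Lemma representsMn g a k : represents g a -> represents (g ^+ k) (a *+ k).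
Proof.
move=> ga; elim: k => [|k IHk]; first exact: represents0.
by rewrite exprS mulrS; apply: representsD.
Qed.

Lemma represents_coord k : c k != 0 -> represents ((c k)^-1 *: 'X_k) (delta k).
Proof. by move=> ck chi _; rewrite mevalZ mevalXU mxE mulKf. Qed.

(** When [Y] is closed it is the closure of the torus image.  Zero constants [c k]
    account for the coordinates of Grassmannian charts that vanish identically,
    and the last clause makes the torus image a surface. *)
Record toric (Y : set 'rV[C]_n) : Prop := Toric {
  toric_sub : forall chi, is_char chi -> Y (torus_pt chi);
  toric_dense : dense_in Y torus;
  toric_nondeg : exists p q, [/\ c p != 0, c q != 0 & det2 (delta p) (delta q) != 0] }.

Section ToricTheory.
Variables (Y : set 'rV[C]_n).
Hypothesis tY : toric Y.

Lemma represents_uniq g h m : represents g m -> represents h m -> vanishing_ideal Y (g - h).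
Proof.
move=> gm hm; apply: (toric_dense tY) => _ [chi cc ->].
by rewrite mevalB gm // hm // subrr.
Qed.

Lemma represents_eval g h m y : represents g m -> represents h m -> Y y -> g.@[y ord0] = h.@[y ord0].
Proof.
move=> gm hm Yy; apply/eqP; rewrite -subr_eq0 -mevalB; apply/eqP.
exact: (represents_uniq gm hm Yy).
Qed.

Lemma represents_dird g h m y W v : represents g m -> represents h m -> is_tangent_space Y y W ->
  v \in W -> dird g y v = dird h y v.
Proof.
move=> gm hm TW vW; apply/eqP; rewrite -subr_eq0 -dirdB; apply/eqP.
by apply: (proj1 (TW v) vW); exact: (represents_uniq gm hm).
Qed.

Definition tangent_mx (chi : int * int -> C) : 'M[C]_(2, n) :=
  \matrix_(a, k) (torus_pt chi 0 k *
    (if a == 0 then (delta k).1 else (delta k).2)%:~R).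

Lemma tangent_mx_mul chi (u : 'rV[C]_2) k :
  (u *m tangent_mx chi) 0 k =
  torus_pt chi 0 k * (u 0 0 * (delta k).1%:~R + u 0 1 * (delta k).2%:~R).
Proof.
rewrite mxE big_ord_recl big_ord1 !mxE (_ : lift _ _ = 1); last exact: val_inj.
by rewrite /=; ring.
Qed.

(** Differentiation along the torus, done formally: the identity
    [\sum_a f_a c^a chi (deg a) = 0], valid for all [chi], remains true when
    [chi (deg a)] is multiplied by a linear form of [deg a], by [char_indep]. *)
Lemma torus_tangent_sub chi u f : is_char chi -> vanishing_ideal Y f ->
  dird f (torus_pt chi) (u *m tangent_mx chi) = 0.
Proof.
move=> cc If; pose l (m : int * int) : C := u 0 0 * m.1%:~R + u 0 1 * m.2%:~R.
have lD a b : l (a + b) = l a + l b.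
  by rewrite /l fstD sndD !intrD; ring.
have l0 : l 0 = 0 by rewrite /l !mulr0 addr0.
have -> : u *m tangent_mx chi = \row_k (torus_pt chi 0 k * l (delta k)).
  by apply/rowP => k; rewrite tangent_mx_mul [RHS]mxE.
rewrite dird_euler.
have := @char_indep C _ (msupp f) (fun a => f@_a * \prod_k c k ^+ a k) mdegZ.
move=> /(_ _ (fun m => chi m * l m)) H.
rewrite -[RHS]H; last first.
  by move=> psi pc; rewrite -meval_torus_pt //; apply: If; apply: toric_sub.
apply: eq_bigr => a _; rewrite -!mulrA; congr (_ * _).
have -> : \prod_k torus_pt chi 0 k ^+ a k = \prod_k c k ^+ a k * chi (mdegZ a).
  rewrite char_sum // -big_split; apply: eq_bigr => k _ /=.
  by rewrite mxE exprMn charMn //.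
rewrite -!mulrA; congr (_ * (_ * _)).
rewrite /mdegZ (big_morph l lD l0); apply: eq_bigr => k _.
by elim: (a k) => [|j IHj]; rewrite ?mulr0n // !mulrS IHj lD.
Qed.

Lemma dird_expM g k (y v : 'rV[C]_n) :
  dird (g ^+ k) y v * g.@[y ord0] = k%:R * (g ^+ k).@[y ord0] * dird g y v.
Proof.
elim: k => [|k IHk]; first by rewrite expr0 dird1 !mul0r.
rewrite exprS dirdM mulrDl -(mulrA _ (dird _ _ _)) IHk mevalM -natr1; ring.
Qed.

Lemma dird_exp0 g k (y v : 'rV[C]_n) : dird g y v = 0 -> dird (g ^+ k) y v = 0.
Proof.
move=> g0; elim: k => [|k IHk]; first by rewrite expr0 dird1.
by rewrite exprS dirdM g0 IHk mul0r mulr0 addr0.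
Qed.

(** A nonzero multiple of [delta k] is an integral combination of [delta p] and
    [delta q].  This yields a binomial equation of [Y], and its differential
    expresses [v 0 k] through [v 0 p] and [v 0 q]. *)
Lemma torus_tangent_inj chi W v p q : is_char chi ->
  is_tangent_space Y (torus_pt chi) W -> v \in W ->
  c p != 0 -> c q != 0 -> det2 (delta p) (delta q) != 0 ->
  v 0 p = 0 -> v 0 q = 0 -> v = 0.
Proof.
move=> cc TW vW cp cq dpq vp vq; apply/rowP => k; rewrite mxE.
have [ck|ck] := eqVneq (c k) 0.
  rewrite -(dirdX k (torus_pt chi) v); apply: (proj1 (TW v) vW).
  apply: (toric_dense tY) => _ [psi _ ->].
  by rewrite mevalXU mxE ck mul0r.
have [d1 [d2 dE]] := int_split (det2 (delta p) (delta q)).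
have [a1 [a2 aE]] := int_split (- det2 (delta k) (delta q)).
have [b1 [b2 bE]] := int_split (- det2 (delta p) (delta k)).
(* Cramer's rule, with negative coefficients moved to the other side. *)
have e : delta k *+ d1 + delta p *+ a1 + delta q *+ b1 =
         delta k *+ d2 + delta p *+ a2 + delta q *+ b2.
  have dE' : d1%:Z = det2 (delta p) (delta q) + d2%:Z by rewrite dE subrK.
  have aE' : a1%:Z = - det2 (delta k) (delta q) + a2%:Z by rewrite aE subrK.
  have bE' : b1%:Z = - det2 (delta p) (delta k) + b2%:Z by rewrite bE subrK.
  apply: Z2P; rewrite !(fstD, sndD, fstMn, sndMn) dE' aE' bE' /det2; ring.
pose g j : {mpoly C[n]} := (c j)^-1 *: 'X_j.
have dg j : dird (g j) (torus_pt chi) v = (c j)^-1 * v 0 j by rewrite dirdZ dirdX.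
have R x y z : represents (g k ^+ x * g p ^+ y * g q ^+ z)
                   (delta k *+ x + delta p *+ y + delta q *+ z).
  by do 2?apply: representsD; apply/representsMn/represents_coord.
have dR x y z : dird (g k ^+ x * g p ^+ y * g q ^+ z) (torus_pt chi) v * (g k).@[torus_pt chi ord0]
   = x%:R * chi (delta k *+ x + delta p *+ y + delta q *+ z) * dird (g k) (torus_pt chi) v.
  have p0 : dird (g p) (torus_pt chi) v = 0 by rewrite dg vp mulr0.
  have q0 : dird (g q) (torus_pt chi) v = 0 by rewrite dg vq mulr0.
  rewrite -(R x y z) // 2!dirdM (dird_exp0 y p0) (dird_exp0 z q0) !mulr0 !addr0.
  have aux (d P Q K X D t : C) : d * K = t * X * D -> d * P * Q * K = t * (X * P * Q) * D.
    by move=> e'; ring: e'.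
  by rewrite !mevalM; apply/aux/dird_expM.
have := dR d1 a1 b1; rewrite (represents_dird (R _ _ _) _ TW vW (h := g k ^+ d2 * g p ^+ a2 * g q ^+ b2)).
  rewrite dR e => /eqP; rewrite -subr_eq0 -!mulrBl !mulf_eq0 (negPf (char_neq0 _ cc)) orbF.
  rewrite dg mulf_eq0 invr_eq0 (negPf ck) /= => /orP[|/eqP //].
  by move: dpq; rewrite dE subr_eq0 eqz_nat => /negPf d12; rewrite subr_eq0 eqr_nat eq_sym d12.
by rewrite e; apply: R.
Qed.

(** The logarithmic derivatives in the two directions of the lattice span the
    tangent space: they lie in it, and by [torus_tangent_inj] it is determined by
    two coordinates. *)
Lemma torus_tangent chi : is_char chi ->
  is_tangent_space Y (torus_pt chi) (row_space (tangent_mx chi)) /\ \rank (tangent_mx chi) = 2.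
Proof.
move=> cc; have [p [q [cp cq dpq]]] := toric_nondeg tY.
have dC : (det2 (delta p) (delta q))%:~R != 0 :> C by rewrite intr_eq0.
have dE : (det2 (delta p) (delta q))%:~R = (delta p).1%:~R * (delta q).2%:~R -
    (delta p).2%:~R * (delta q).1%:~R :> C by rewrite /det2 rmorphB !rmorphM.
have xn k : c k != 0 -> torus_pt chi 0 k != 0.
  by move=> ck; rewrite mxE mulf_neq0 // char_neq0.
split.
  have [W TW] := tangent_exists Y (torus_pt chi).
  suff -> : row_space (tangent_mx chi) = W by [].
  have TsW u : u *m tangent_mx chi \in W.
    by apply/TW => f If; apply: torus_tangent_sub.
  apply/vspaceP => v; rewrite mem_row_space; apply/idP/idP => [/submxP[u ->] //|vW].
  have aux (d x y x' y' s t : C) : d != 0 -> d = x * y' - y * x' ->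
     (s * y' - t * y) / d * x + (x * t - x' * s) / d * y = s /\
     (s * y' - t * y) / d * x' + (x * t - x' * s) / d * y' = t.
    by move=> d0 d0E; split; rewrite d0E; field; rewrite -d0E.
  have [e1 e2] := aux _ _ _ _ _ (v 0 p / torus_pt chi 0 p) (v 0 q / torus_pt chi 0 q) dC dE.
  set u0 := (_ / _) in e1 e2; set u1 := ((_ - _) / _) in e1 e2.
  pose u : 'rV[C]_2 := \row_a (if a == 0 then u0 else u1).
  have uE k : (u *m tangent_mx chi) 0 k =
      torus_pt chi 0 k * (u0 * (delta k).1%:~R + u1 * (delta k).2%:~R).
    by rewrite tangent_mx_mul !mxE.
  apply/submxP; exists u; apply/eqP; rewrite -subr_eq0; apply/eqP.
  apply: (torus_tangent_inj cc TW _ cp cq dpq); first by rewrite memvB // TsW.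
    by rewrite 2!mxE uE e1 mulrC divfK ?subrr // xn.
  by rewrite 2!mxE uE e2 mulrC divfK ?subrr // xn.
apply/eqP/inj_row_free => u uT.
have uE k : c k != 0 -> u 0 0 * (delta k).1%:~R + u 0 1 * (delta k).2%:~R = 0.
  move=> ck; apply: (mulfI (xn k ck)); rewrite -tangent_mx_mul uT mxE mulr0 //.
have aux (x y x' y' s t : C) : s * x + t * y = 0 -> s * x' + t * y' = 0 ->
    x * y' - y * x' != 0 -> s = 0 /\ t = 0.
  move=> e e' d0; split; apply: (mulfI d0); rewrite mulr0.
    transitivity (y' * (s * x + t * y) - y * (s * x' + t * y')); first by ring.
    by rewrite e e' !mulr0 subr0.
  transitivity (x * (s * x' + t * y') - x' * (s * x + t * y)); first by ring.
  by rewrite e e' !mulr0 subr0.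
have [|u0 u1] := aux _ _ _ _ _ _ (uE p cp) (uE q cq); first by rewrite -dE.
have one : lift ord0 ord0 = 1 :> 'I_2 by apply: val_inj.
apply/rowP => i; rewrite mxE; case: (unliftP ord0 i) => [j ->|->]; last exact: u0.
by rewrite (ord1 j) one u1.
Qed.

End ToricTheory.
End Param.
End Toric.

(** * Parametrized varieties are surfaces *)

Section ToricDim.
Context {C : numFieldType}.
Variables (n : nat) (delta : 'I_n -> int * int) (c : 'I_n -> C) (Y : set 'rV[C]_n).
Hypothesis tY : toric delta c Y.

Lemma laurent_seq (r : seq (C * (int * int))) phi :
  (forall chi, is_char chi -> phi chi = \sum_(x <- r) x.1 * chi x.2) ->
  exists h, laurent h phi.
Proof.
move=> rE; exists (\sum_(x <- r) (absz x.2.1 + absz x.2.2))%N; exists r => // x xr.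
rewrite (big_rem x) //= !PoszD !abszE -addrA.
by apply/andP; split; [|rewrite addrCA]; rewrite lerDl addr_ge0.
Qed.

Lemma toric_dim_le2 e (f : 'I_e -> {mpoly C[n]}) : alg_independent Y f -> (e <= 2)%N.
Proof.
move=> fI; rewrite leqNgt; apply/negP => e2.
have fL i : exists h, laurent h (fun chi => (f i).@[torus_pt delta c chi ord0]).
  apply: (@laurent_seq
    [seq ((f i)@_a * \prod_k c k ^+ a k, mdegZ delta a) | a <- msupp (f i)]).
  by move=> chi cc; rewrite (meval_torus_pt _ _ _ cc) [RHS]big_map.
have [P P0 HP] := laurent_dep e2 fL.
move/eqP: P0; apply; apply: fI => x Yx.
have := @toric_dense _ _ _ _ _ tY (P \mPo [tuple f i | i < e]) _ x Yx.
rewrite comp_mpoly_meval => H; rewrite -[RHS]H.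
  by apply: meval_eq => i; rewrite tnth_mktuple.
move=> _ [chi cc ->]; rewrite comp_mpoly_meval -[RHS](HP chi cc).
by apply: meval_eq => i; rewrite tnth_mktuple.
Qed.

(** Monomials in two coordinates with independent exponents have pairwise
    distinct exponents on the torus. *)
Lemma toric_dim_ge2 p q : c p != 0 -> c q != 0 -> det2 (delta p) (delta q) != 0 ->
  alg_independent Y (fun i : 'I_2 => 'X_(if i == 0 then p else q)).
Proof.
move=> cp cq dpq P PY; apply/mpolyP => b; rewrite mcoeff0; apply/eqP.
have [bP|/memN_msupp_eq0 -> //] := boolP (b \in msupp P).
pose deg (a : 'X_{1..2}) := delta p *+ a 0 + delta q *+ a 1.
have degI : injective deg.
  move=> a a' e; have e1 := congr1 fst e; have e2 := congr1 snd e.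
  move: e1 e2; rewrite /deg !fstD !sndD !fstMn !sndMn => e1 e2.
  have d0 : det2 (delta p) (delta q) * (a 0)%:Z = det2 (delta p) (delta q) * (a' 0)%:Z.
    rewrite /det2; apply/eqP; rewrite -subr_eq0; apply/eqP.
    transitivity ((delta q).2 * (((delta p).1 * (a 0)%:Z + (delta q).1 * (a 1)%:Z) -
     ((delta p).1 * (a' 0)%:Z + (delta q).1 * (a' 1)%:Z)) -
     (delta q).1 * (((delta p).2 * (a 0)%:Z + (delta q).2 * (a 1)%:Z) -
     ((delta p).2 * (a' 0)%:Z + (delta q).2 * (a' 1)%:Z))); first by ring.
    by rewrite e1 e2 !subrr !mulr0 subrr.
  have d1 : det2 (delta p) (delta q) * (a 1)%:Z = det2 (delta p) (delta q) * (a' 1)%:Z.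
    rewrite /det2; apply/eqP; rewrite -subr_eq0; apply/eqP.
    transitivity ((delta p).1 * (((delta p).2 * (a 0)%:Z + (delta q).2 * (a 1)%:Z) -
     ((delta p).2 * (a' 0)%:Z + (delta q).2 * (a' 1)%:Z)) -
     (delta p).2 * (((delta p).1 * (a 0)%:Z + (delta q).1 * (a 1)%:Z) -
     ((delta p).1 * (a' 0)%:Z + (delta q).1 * (a' 1)%:Z))); first by ring.
    by rewrite e1 e2 !subrr !mulr0 subrr.
  have one : lift ord0 ord0 = 1 :> 'I_2 by apply: val_inj.
  move/(mulfI dpq): d0 => [d0]; move/(mulfI dpq): d1 => [d1].
  apply/mnmP => i; case: (unliftP ord0 i) => [j ->|-> //].
  by rewrite (ord1 j) one.
have key chi : is_char chi ->
    \sum_(a <- msupp P) (P@_a * (c p ^+ a 0 * c q ^+ a 1)) * chi (deg a) = 0.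
  move=> cc; rewrite -[RHS](PY _ (toric_sub tY cc)) mevalE; apply: eq_bigr => a _.
  rewrite -!mulrA; congr (_ * _).
  rewrite big_ord_recl big_ord1 (_ : lift ord0 ord0 = 1); last exact: val_inj.
  by rewrite /= !mevalXU !mxE (proj2 cc) !charMn // !exprMn mulrACA mulrA.
have /eqP := char_indep key (fun m => (m == deg b)%:R).
rewrite (bigD1_seq b) ?msupp_uniq //= eqxx mulr1 big1 => [|a ab]; last first.
  by rewrite (inj_eq degI) (negPf ab) mulr0.
by rewrite addr0 !mulf_eq0 !expf_eq0 (negPf cp) (negPf cq) !andbF !orbF.
Qed.

Lemma toric_dimension : dimension Y = 2%N.
Proof.
have [p [q [cp cq dpq]]] := toric_nondeg tY.
apply/eqP; rewrite eqn_leq; apply/andP; split.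
  by apply/bigmax_leqP => e /asboolP[f]; exact: toric_dim_le2.
have n2 : (2 < n.+1)%N.
  rewrite ltnS -[n]card_ord; apply: leq_trans (max_card [set p; q]).
  rewrite cards2; case: eqVneq => // pq; move: dpq.
  by rewrite pq /det2 mulrC subrr eqxx.
apply: (@leq_bigmax_cond _ _ _ (Ordinal n2)); apply/asboolP; eexists.
exact: toric_dim_ge2 cp cq dpq.
Qed.

Lemma torus_tangent_dim chi W : is_char chi -> is_tangent_space Y (torus_pt delta c chi) W ->
  \dim W = 2%N.
Proof.
move=> cc TW; have [T r2] := torus_tangent tY cc.
by rewrite (tangent_uniq TW T) dim_row_space r2.
Qed.

Lemma torus_nonsingular chi : is_char chi -> nonsingular_at Y (torus_pt delta c chi).
Proof.
move=> cc; split; first exact: (toric_sub tY).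
have [T r2] := torus_tangent tY cc.
by eexists; split; first exact: T; rewrite dim_row_space r2 toric_dimension.
Qed.

Lemma toric_tangent_ge2 y W : Y y -> is_tangent_space Y y W -> (2 <= \dim W)%N.
Proof.
move=> Yy TW; apply: (tangent_semicontinuous (toric_dense tY) _ Yy TW).
by move=> x V [chi cc ->] TV; rewrite (torus_tangent_dim cc TV).
Qed.

End ToricDim.

(** * A chart of the Nash blowup is again parametrized by the torus *)

Section Exponents.
Implicit Types (S : int * int -> Prop) (p q u v m s : int * int).

(** [p] and [q] are the exponents of the two coordinates which define the
    Grassmannian chart.  By Cramer's rule the entries of the normalized tangent
    matrix are the monomials of exponents [s - p] and [s - q], with coefficients
    proportional to [det2 s q] and [det2 s p]; only those with nonzero
    coefficient count. *)
Definition nash_exps S p q m :=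
  [\/ S m, exists s, [/\ S s, det2 s q != 0 & m = s - p]
         | exists s, [/\ S s, det2 s p != 0 & m = s - q]].

Inductive nspan S : int * int -> Prop :=
| nspan0 : nspan S 0
| nspanS m s : S s -> nspan S m -> nspan S (s + m).

(** For [S] of rank 2, the semigroup spanned by [S] is then N^2, or Z x N, or Z^2.
    The last two are not told apart: if [u] is invertible and some exponent has a
    negative coefficient on [v], then [v] is invertible as well. *)
Definition smooth_exps S := exists u v, [/\ nspan S u, nspan S v &
  (forall m, S m -> exists a b : nat, m = u *+ a + v *+ b) \/
  (nspan S (- u) /\ forall m, S m -> exists a b : int, m = u *~ a + v *~ b)].

End Exponents.

Section NashToric.
Context {C : numFieldType}.

Definition exponents n (delta : 'I_n -> int * int) (c : 'I_n -> C) (m : int * int) :=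
  exists2 k, c k != 0 & delta k = m.

(** [A = K * B] with [K] the identity on the coordinates in [J]. *)
Lemma normalized_uniq n (J : {set 'I_n}) (A B : 'M[C]_n) :
  normalized J A -> normalized J B -> row_space A = row_space B -> A = B.
Proof.
move=> /normalizedP[EA AE] /normalizedP[EB BE] rAB.
have /submxP[K AK] : (A <= B)%MS.
  by apply/row_subP => k; rewrite -mem_row_space -rAB mem_row_space row_sub.
have KE : K *m coord_proj J = coord_proj J by rewrite -BE mulmxA -AK AE.
by rewrite AK -{1}EB mulmxA KE EB.
Qed.

Section Step.
Variables (n : nat) (delta : 'I_n -> int * int) (c : 'I_n -> C) (Y : set 'rV[C]_n).
Hypothesis tY : toric delta c Y.

Section Pair.
Variables (i j : 'I_n).
Hypotheses (ci : c i != 0) (cj : c j != 0) (dij : det2 (delta i) (delta j) != 0).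
Let J : {set 'I_n} := [set i; j].

Let ij : i != j.
Proof. by apply: contraNneq dij => ->; rewrite /det2 mulrC subrr. Qed.

(** Up to the factors [c k / c i] and [c k / c j], rows [i] and [j] hold the
    coefficients of [delta k] in terms of [delta i] and [delta j]. *)
Definition nash_coef : 'M[C]_n := \matrix_(l, k)
  if l == i then c k / c i * (det2 (delta k) (delta j))%:~R / (det2 (delta i) (delta j))%:~R
  else if l == j
  then c k / c j * (det2 (delta i) (delta k))%:~R / (det2 (delta i) (delta j))%:~R
  else 0.

Definition nash_mx (chi : int * int -> C) : 'M[C]_n :=
  \matrix_(l, k) (nash_coef l k * chi (delta k - delta l)).

Lemma nash_mx_normalized chi : is_char chi -> normalized J (nash_mx chi).
Proof.
case=> c1 _ l k; have dC : (det2 (delta i) (delta j))%:~R != 0 :> C by rewrite intr_eq0.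
have det0 m : det2 m m = 0 by rewrite /det2 mulrC subrr.
rewrite !inE; split=> [|/orP lJ /orP kJ].
  by rewrite negb_or => /andP[li lj]; rewrite !mxE (negPf li) (negPf lj) mul0r.
case: lJ kJ => /eqP-> [] /eqP->; rewrite !mxE ?eqxx ?subrr ?c1 ?det0.
- by rewrite divff // mul1r divff // mulr1.
- by rewrite (negPf ij) mulr0 !mul0r.
- by rewrite (eq_sym j) (negPf ij) mulr0 !mul0r.
- by rewrite (eq_sym j) (negPf ij) divff // mul1r divff // mulr1.
Qed.

Lemma nash_mx_tangent chi : is_char chi ->
  row_space (nash_mx chi) = row_space (tangent_mx delta c chi).
Proof.
move=> cc; set T := tangent_mx _ _ _; set B := nash_mx _.
have dC : (det2 (delta i) (delta j))%:~R != 0 :> C by rewrite intr_eq0.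
have nB := nash_mx_normalized cc.
have TB : T = T *m B.
  apply/matrixP => a k; rewrite [RHS]mxE (bigD1 i) //= (bigD1 j) ?(eq_sym j) //=.
  rewrite big1 ?addr0; last first.
    move=> l /andP[li lj]; rewrite (_ : B l k = 0) ?mulr0 //.
    by rewrite !mxE (negPf li) (negPf lj) mul0r.
  rewrite !mxE eqxx (eq_sym j) (negPf ij) eqxx.
  have chiB m m' : chi (m - m') = chi m / chi m'.
    apply: (mulIf (char_neq0 m' cc)).
    by rewrite -(proj2 cc) subrK divfK // char_neq0.
  rewrite !chiB.
  have aux (D w A K A' K' ck x ci' x' cj' x'' : C) : D != 0 -> ci' != 0 -> x' != 0 ->
      cj' != 0 -> x'' != 0 -> D * w = A * K + A' * K' ->
      ck * x * w = ci' * x' * A * (ck / ci' * K / D * (x / x')) +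
                   cj' * x'' * A' * (ck / cj' * K' / D * (x / x'')).
    move=> D0 i0 x0 j0 y0 E; apply: (mulfI D0); rewrite mulrCA E; field.
    by rewrite D0 i0 x0 j0 y0.
  apply: aux => //; try exact: char_neq0.
  rewrite -!intrM -intrD; congr (_%:~R); rewrite /det2; case: (a == 0); ring.
apply/esym/row_space_eqmx/eqmxP.
have TsB : (T <= B)%MS by rewrite TB submxMl.
rewrite TsB -(geq_leqif (mxrank_leqif_sup TsB)) (rank_normalized nB).
by rewrite cards2 ij (proj2 (torus_tangent tY cc)).
Qed.

Definition nash_delta (t : 'I_(n + n * n)) : int * int :=
  row_mx (\row_k delta k) (mxvec (\matrix_(l, k) (delta k - delta l))) 0 t.
Definition nash_c (t : 'I_(n + n * n)) : C :=
  row_mx (\row_k c k) (mxvec nash_coef) 0 t.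

Lemma nash_torus_pt chi :
  torus_pt nash_delta nash_c chi = chart_pt (torus_pt delta c chi) (nash_mx chi).
Proof.
apply/rowP => t; rewrite mxE /nash_delta /nash_c /chart_pt.
case: (split_ordP t) => k ->; rewrite ?row_mxEl ?row_mxEr ?mxE //.
by case/mxvec_indexP: k => l k; rewrite !mxvecE !mxE.
Qed.

(** The entries 1 of the normalized matrix contribute the exponent 0, which is
    [p - p] in [nash_exps]. *)
Lemma nash_exponents m : exponents nash_delta nash_c m <->
  nash_exps (exponents delta c) (delta i) (delta j) m.
Proof.
have dC : (det2 (delta i) (delta j))%:~R != 0 :> C by rewrite intr_eq0.
have detN a b : (det2 a b == 0) = (det2 b a == 0).
  by rewrite -oppr_eq0 /det2; congr (_ == 0); ring.
rewrite /nash_exps /exponents /nash_delta /nash_c; split.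
  case=> t; case: (split_ordP t) => k ->.
    by rewrite !row_mxEl !mxE => ck dk; apply: Or31; exists k.
  rewrite !row_mxEr; case/mxvec_indexP: k => l k; rewrite !mxvecE !mxE.
  case: (eqVneq l i) => [->|_]; last case: (eqVneq l j) => [->|_]; rewrite ?eqxx //.
    rewrite !mulf_eq0 !invr_eq0 (negPf ci) (negPf dC) intr_eq0 !orbF negb_or.
    case/andP=> ck dk <-; apply: Or32; exists (delta k); split=> //.
    by exists k.
  rewrite !mulf_eq0 !invr_eq0 (negPf cj) (negPf dC) intr_eq0 !orbF negb_or.
  case/andP=> ck dk <-; apply: Or33; exists (delta k); split=> //; last by rewrite detN.
  by exists k.
case=> [[k ck dk]|[s [[k ck <-] dk ->]]|[s [[k ck <-] dk ->]]].
- by exists (lshift _ k); rewrite !row_mxEl !mxE.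
- exists (rshift n (mxvec_index i k)); rewrite !row_mxEr !mxvecE !mxE // eqxx.
  by rewrite !mulf_neq0 ?invr_eq0 ?intr_eq0.
exists (rshift n (mxvec_index j k)); rewrite !row_mxEr !mxvecE !mxE // eqxx.
by rewrite (eq_sym j) (negPf ij) !mulf_neq0 ?invr_eq0 ?intr_eq0 // detN.
Qed.

Lemma nash_chart_toric : toric nash_delta nash_c (gr_chart J (affine_nash Y)).
Proof.
have cJ : #|J| = dimension Y by rewrite (toric_dimension tY) cards2 ij.
split.
- move=> chi cc; have [T r2] := torus_tangent tY cc.
  rewrite nash_torus_pt /gr_chart pt_chart_pt mx_chart_pt; split; first exact: nash_mx_normalized.
  rewrite (nash_mx_tangent cc); split; first exact: (toric_sub tY).
  split; first by rewrite dim_row_space r2 (toric_dimension tY).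
  move=> Z cZ; apply; split=> //=; exact: (torus_nonsingular tY).
- move=> f fT; apply: (nash_chart_closure (toric_dense tY) cJ).
    move=> x W [chi cc ->] TW.
    by rewrite (toric_dimension tY) (torus_tangent_dim tY cc TW).
  move=> x B [chi cc ->] nB TB.
  have [T r2] := torus_tangent tY cc.
  suff -> : B = nash_mx chi by rewrite -nash_torus_pt; apply: fT; exists chi.
  apply: (normalized_uniq nB (nash_mx_normalized cc)).
  by rewrite (nash_mx_tangent cc) (tangent_uniq TB T).
- have [p [q [cp cq dpq]]] := toric_nondeg tY.
  exists (lshift _ p), (lshift _ q).
  by rewrite /nash_delta /nash_c !row_mxEl !mxE.
Qed.

End Pair.

(** The columns [i] and [j] of a normalized matrix of the tangent space form an
    identity matrix, so the corresponding columns of [tangent_mx] are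
    independent. *)
Lemma nondegenerate_chart chi i j B : is_char chi ->
  normalized [set i; j] B -> is_tangent_space Y (torus_pt delta c chi) (row_space B) ->
  [/\ c i != 0, c j != 0 & (i != j) ==> (det2 (delta i) (delta j) != 0)].
Proof.
move=> cc nB TB; have [T r2] := torus_tangent tY cc.
have rB := tangent_uniq TB T.
have /submxP[K BK] : (B <= tangent_mx delta c chi)%MS.
  by apply/row_subP => k; rewrite -mem_row_space -rB mem_row_space row_sub.
have BE l k : B l k = torus_pt delta c chi 0 k *
    (K l 0 * (delta k).1%:~R + K l 1 * (delta k).2%:~R).
  have := tangent_mx_mul delta c chi (row l K) k; rewrite !mxE => <-.
  by rewrite BK mxE; apply: eq_bigr => a _; rewrite !mxE.
have iJ : i \in [set i; j] by rewrite !inE eqxx.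
have jJ : j \in [set i; j] by rewrite !inE eqxx orbT.
have c0 k : k \in [set i; j] -> c k != 0.
  move=> kJ; apply/eqP => ck; have := proj2 (nB k k) kJ kJ.
  by rewrite BE mxE ck !mul0r eqxx => /eqP; rewrite eq_sym oner_eq0.
split; [exact: c0 | exact: c0 | apply/implyP => ij; apply/eqP => d0].
have xn k : k \in [set i; j] -> torus_pt delta c chi 0 k != 0.
  by move=> /c0 ck; rewrite mxE mulf_neq0 // char_neq0.
have E1 := proj2 (nB i i) iJ iJ; have E2 := proj2 (nB i j) iJ jJ.
have E3 := proj2 (nB j i) jJ iJ; have E4 := proj2 (nB j j) jJ jJ.
rewrite eqxx BE in E1; rewrite (negPf ij) BE in E2.
rewrite eq_sym (negPf ij) BE in E3; rewrite eqxx BE in E4.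
have dC : (delta i).1%:~R * (delta j).2%:~R = (delta i).2%:~R * (delta j).1%:~R :> C.
  by rewrite -!intrM; congr (_%:~R); apply/eqP; rewrite -subr_eq0; apply/eqP.
have : true%:R * true%:R = false%:R * false%:R :> C.
  rewrite -{1}E1 -{1}E4 -{1}E2 -E3.
  have aux (X Y' a b x y k l k' l' : C) : x * b = y * a ->
    X * (k * x + l * y) * (Y' * (k' * a + l' * b)) =
    Y' * (k * a + l * b) * (X * (k' * x + l' * y)).
    move=> e; apply/eqP; rewrite -subr_eq0; apply/eqP.
    transitivity (X * Y' * (k * l' - l * k') * (x * b - y * a)); first by ring.
    by rewrite e subrr mulr0.
  exact: aux.
by rewrite mulr1 mulr0 => /eqP; rewrite oner_eq0.
Qed.

(** If the pair [J] is degenerate, no tangent space at a torus point lies in its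
    chart, so the constant 1 vanishes on the part of the graph that lies over
    the torus and in the chart, hence on the whole chart, which is therefore
    empty. *)
Lemma nash_toric (J : {set 'I_n}) y : gr_chart J (affine_nash Y) y ->
  exists p q delta' c', [/\ exponents delta c p, exponents delta c q, det2 p q != 0,
    @toric C _ delta' c' (gr_chart J (affine_nash Y)) &
    forall m, exponents delta' c' m <-> nash_exps (exponents delta c) p q m].
Proof.
move=> Jy; have cJ : #|J| = 2%N.
  case: Jy => ny [_ [/= dy _]].
  by rewrite -(rank_normalized ny) -dim_row_space dy (toric_dimension tY).
have /cards2P[i [j [ij JE]]] := introT eqP cJ.
suff [ci cj dij] : [/\ c i != 0, c j != 0 & det2 (delta i) (delta j) != 0].
  exists (delta i), (delta j), nash_delta, (nash_c i j).
  split=> //; [by exists i | by exists j | |].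
    by rewrite JE; apply: nash_chart_toric.
  by move=> m; apply: nash_exponents.
apply: contrapT => deg.
suff /(_ y Jy) : vanishing_ideal (gr_chart J (affine_nash Y)) 1.
  by rewrite meval1 => /eqP; rewrite oner_eq0.
apply: (nash_chart_closure (toric_dense tY)); rewrite ?(toric_dimension tY) //.
  by move=> x W [chi cc ->] TW; apply: (torus_tangent_dim tY cc TW).
move=> x B [chi cc ->] nB TB; case: deg; rewrite JE in nB.
by have [ci cj /implyP/(_ ij)] := nondegenerate_chart cc nB TB.
Qed.

End Step.
End NashToric.

(** * Smoothness read off the exponents *)

Section SmoothToric.
Context {C : numFieldType}.
Variables (n : nat) (delta : 'I_n -> int * int) (c : 'I_n -> C) (Y : set 'rV[C]_n).
Hypothesis tY : toric delta c Y.

Lemma nspan_represented m : nspan (exponents delta c) m -> exists g, represents delta c g m.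
Proof.
elim=> [|m' s [k ck <-] _ [g gs]]; first by exists 1; exact: represents0.
by eexists; apply: representsD gs; apply: represents_coord ck.
Qed.

Lemma dim_le_inj (W : {vspace 'rV[C]_n}) k (G : 'M[C]_(n, k)) :
  (forall v, v \in W -> v *m G = 0 -> v = 0) -> (\dim W <= k)%N.
Proof.
move=> inj; have [f fE] : exists f : 'Hom('rV[C]_n, 'rV[C]_k), forall v, f v = v *m G.
  by exists (linfun (mulmxr G)) => v; rewrite lfunE.
rewrite -(@limg_dim_eq _ _ _ f).
  apply: leq_trans (dimvS (subvf _)) _.
  by rewrite dimvf /dim /= mul1n.
apply/eqP; rewrite -subv0; apply/subvP => v; rewrite memv_cap memv_ker fE.
by case/andP=> vW /eqP/(inj _ vW)->; rewrite mem0v.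
Qed.

Section Kill.
Variables (y : 'rV[C]_n) (W : {vspace 'rV[C]_n}) (v : 'rV[C]_n).
Hypotheses (Yy : Y y) (TW : is_tangent_space Y y W) (vW : v \in W).

(** Exponents whose monomials have zero derivative at [y] along the tangent
    vector [v]; they form a semigroup by Leibniz's rule. *)
Definition killed m := exists2 g, represents delta c g m & dird g y v = 0.

Lemma killed0 : killed 0.
Proof. by exists 1; [exact: represents0 | exact: dird1]. Qed.

Lemma killedD a b : killed a -> killed b -> killed (a + b).
Proof.
move=> [g ga dg] [h hb dh]; exists (g * h); first exact: representsD.
by rewrite dirdM dg dh mul0r mulr0 addr0.
Qed.

Lemma killedMn a k : killed a -> killed (a *+ k).
Proof.
by move=> Ka; elim: k => [|k IHk]; rewrite ?mulrS; [exact: killed0 | exact: killedD].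
Qed.

(** The monomials of exponents [a] and [- a] have product 1 on [Y], so the first
    one does not vanish at [y] and Leibniz's rule applies. *)
Lemma killedN a : killed a -> nspan (exponents delta c) (- a) -> killed (- a).
Proof.
move=> [g ga dg] /nspan_represented[h ha]; exists h => //.
have gh : represents delta c (g * h) 0 by rewrite -(subrr a); exact: representsD.
have /eqP := represents_dird tY gh (represents0 _ _) TW vW.
rewrite dirdM dg mul0r add0r dird1 mulf_eq0 => /orP[/eqP g0|/eqP //].
have /eqP := represents_eval tY gh (represents0 _ _) Yy.
by rewrite mevalM g0 mul0r meval1 eq_sym oner_eq0.
Qed.

Lemma killed_coord : (forall m, exponents delta c m -> killed m) -> v = 0.
Proof.
move=> K; apply/rowP => k; rewrite mxE.
have [ck|ck] := eqVneq (c k) 0.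
  rewrite -(dirdX k y v); apply: (proj1 (TW v) vW).
  apply: (toric_dense tY) => _ [psi _ ->].
  by rewrite mevalXU mxE ck mul0r.
have [|g gk dg] := K (delta k); first by exists k.
have := represents_dird tY gk (represents_coord _ ck) TW vW.
rewrite dg dirdZ dirdX => /esym/eqP.
by rewrite mulf_eq0 invr_eq0 (negPf ck) => /eqP.
Qed.

End Kill.

Lemma nspanD S a b : nspan S a -> nspan S b -> nspan S (a + b).
Proof. by move=> Sa Sb; elim: Sa => [|m s Sm _ IH]; rewrite ?add0r // -addrA; apply: nspanS. Qed.

Lemma nspanMn S a k : nspan S a -> nspan S (a *+ k).
Proof.
by move=> Sa; elim: k => [|k IHk]; rewrite ?mulrS; [exact: nspan0 | exact: nspanD].
Qed.

Lemma nspan1 S a : S a -> nspan S a.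
Proof. by move=> Sa; rewrite -[a]addr0; apply: nspanS => //; exact: nspan0. Qed.

(** A tangent vector killing the monomials of exponents [u] and [w] kills those of
    all exponents, hence is zero: the tangent space has dimension at most 2.
    Semicontinuity gives the other bound. *)
Lemma toric_smooth y : smooth_exps (exponents delta c) -> Y y -> nonsingular_at Y y.
Proof.
move=> [u [w [Nu Nw gen]]] Yy; split=> //.
have [W TW] := tangent_exists Y y; exists W; split=> //.
rewrite (toric_dimension tY); apply/eqP; rewrite eqn_leq (toric_tangent_ge2 tY Yy TW).
rewrite andbT.
have [gu ru] := nspan_represented Nu; have [gw rw] := nspan_represented Nw.
apply: (@dim_le_inj W 2 (\matrix_(k, a) (if a == 0 then gu else gw)^`M(k).@[y ord0])).
move=> v vW vG.
have Ku : killed y v u.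
  exists gu => //; have /rowP/(_ 0) := vG; rewrite !mxE => /(etrans _); apply.
  by apply: eq_bigr => k _; rewrite !mxE mulrC.
have Kw : killed y v w.
  exists gw => //; have /rowP/(_ 1) := vG; rewrite !mxE => /(etrans _); apply.
  by apply: eq_bigr => k _; rewrite !mxE mulrC.
apply: (killed_coord TW vW) => m Sm.
case: gen => [/(_ m Sm)[a [b ->]]|[NuN /(_ m Sm)[a [b mE]]]].
  by apply: killedD; apply: killedMn.
have KuN : killed y v (- u) by apply: (killedN Yy TW vW).
have Nua (z : int) : nspan (exponents delta c) (u *~ z).
  case: z => k; first by rewrite -pmulrn; apply: nspanMn.
  by rewrite NegzE mulrNz -pmulrn -mulNrn; apply: nspanMn.
have Kua : killed y v (u *~ a).
  case: (a) => k; first by rewrite -pmulrn; apply: killedMn.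
  by rewrite NegzE mulrNz -pmulrn -mulNrn; apply: killedMn.
rewrite mE; apply: killedD => //.
case: b mE => b mE; first by rewrite -pmulrn; apply: killedMn.
rewrite NegzE mulrNz -pmulrn -mulNrn; apply: killedMn.
apply: (killedN Yy TW vW Kw).
(* Here the coefficient of [w] is negative, so that [- w] is in the semigroup. *)
have -> : - w = m + u *~ (- a) + w *+ b.
  rewrite mE NegzE !mulrNz -pmulrn mulrSr [u *~ a + _]addrC addrK.
  by rewrite opprD addrC addrA subrr add0r.
apply: nspanD; last exact: nspanMn.
by apply: nspanD => //; apply: nspan1.
Qed.

End SmoothToric.

(** * Nash blowup of a cone over a rational normal curve *)

Section Combinatorics.
Implicit Types (S T : int * int -> Prop) (u v w f p q m s : int * int).

Lemma fstMz u (z : int) : (u *~ z).1 = u.1 * z.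
Proof.
case: z => k; first by rewrite -pmulrn fstMn.
by rewrite NegzE mulrNz mulrN -pmulrn -fstMn.
Qed.
Lemma sndMz u (z : int) : (u *~ z).2 = u.2 * z.
Proof.
case: z => k; first by rewrite -pmulrn sndMn.
by rewrite NegzE mulrNz mulrN -pmulrn -sndMn.
Qed.

Definition comb u v (x y : int) : int * int := u *~ x + v *~ y.

Lemma combE1 u v x y : (comb u v x y).1 = u.1 * x + v.1 * y.
Proof. by rewrite /comb fstD !fstMz. Qed.
Lemma combE2 u v x y : (comb u v x y).2 = u.2 * x + v.2 * y.
Proof. by rewrite /comb sndD !sndMz. Qed.

Lemma fstN u : (- u).1 = - u.1. Proof. by []. Qed.
Lemma sndN u : (- u).2 = - u.2. Proof. by []. Qed.

Definition coordE := (fstD, sndD, fstN, sndN, fstMn, sndMn, fstMz, sndMz, combE1, combE2).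

Lemma combD u v x y x' y' : comb u v x y + comb u v x' y' = comb u v (x + x') (y + y').
Proof. by apply: Z2P; rewrite !coordE; ring. Qed.
Lemma combN u v x y : - comb u v x y = comb u v (- x) (- y).
Proof. by apply: Z2P; rewrite !coordE; ring. Qed.
Lemma combMn u v x y k : comb u v x y *+ k = comb u v (x * k%:Z) (y * k%:Z).
Proof. by apply: Z2P; rewrite !coordE; ring. Qed.
Lemma det_comb u v x y x' y' :
  det2 (comb u v x y) (comb u v x' y') = (x * y' - y * x') * det2 u v.
Proof. by rewrite /det2 !coordE; ring. Qed.
Lemma comb10 u v : comb u v 1 0 = u.
Proof. by apply: Z2P; rewrite !coordE; ring. Qed.
Lemma comb01 u v : comb u v 0 1 = v.
Proof. by apply: Z2P; rewrite !coordE; ring. Qed.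
Lemma comb00 u v : comb u v 0 0 = 0.
Proof. by apply: Z2P; rewrite !coordE; ring. Qed.

Lemma basis_gen u v : `|det2 u v| = 1 -> forall m, exists a b : int, m = u *~ a + v *~ b.
Proof.
move=> d1 m; exists (det2 u v * det2 m v), (det2 u v * det2 u m).
have dd : det2 u v * det2 u v = 1 by move: d1; lia.
apply: Z2P; rewrite !coordE.
  by rewrite -[LHS]mul1r -dd /det2; ring.
by rewrite -[LHS]mul1r -dd /det2; ring.
Qed.

Lemma nspan_mono S T m : (forall s, S s -> T s) -> nspan S m -> nspan T m.
Proof.
by move=> ST; elim=> [|m' s Ss _ IH]; [exact: nspan0 | apply: nspanS => //; exact: ST].
Qed.

Lemma smooth_ext S T : (forall m, S m <-> T m) -> smooth_exps S -> smooth_exps T.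
Proof.
move=> ST [u [v [Nu Nv H]]]; have NST m : nspan S m -> nspan T m.
  by apply: nspan_mono => s /ST.
exists u, v; split; [exact: NST | exact: NST |].
case: H => [H|[Nu' H]]; [left=> m /ST; exact: H | right; split; first exact: NST].
by move=> m /ST; exact: H.
Qed.

Definition has_unit S := exists u v,
  [/\ nspan S u, nspan S (- u), nspan S v & `|det2 u v| = 1].

Lemma has_unit_smooth S : has_unit S -> smooth_exps S.
Proof.
move=> [u [v [Nu Nu' Nv d1]]]; exists u, v; split=> //; right; split=> // m _.
exact: basis_gen.
Qed.

Lemma nash_swap S p q m : nash_exps S p q m -> nash_exps S q p m.
Proof. by case=> H; [exact: Or31 | exact: Or33 | exact: Or32]. Qed.

Lemma nash_mono S T p q m :
  (forall s, S s -> T s) -> nash_exps S p q m -> nash_exps T p q m.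
Proof.
move=> ST [H|[x [Hx Hd ->]]|[x [Hx Hd ->]]].
- exact/Or31/ST.
- by apply: Or32; exists x; split=> //; exact: ST.
by apply: Or33; exists x; split=> //; exact: ST.
Qed.

Lemma has_unit_mono S T : (forall s, S s -> T s) -> has_unit S -> has_unit T.
Proof.
by move=> ST [u [v [Nu Nu' Nv d1]]]; exists u, v; split=> //; apply: (nspan_mono ST).
Qed.

(** In the basis [w], [f] the semigroup spanned by [S] consists of the points
    [(h, a)] with [0 <= a <= r * h]: these are the exponents of the
    cone over the rational normal curve of degree [r], and the generators are
    [e_i = comb w f 1 i]. *)
Section Cone.
Variables (w f : int * int) (r : int) (S : int * int -> Prop).
Hypotheses (dwf : `|det2 w f| = 1) (r2 : 2 <= r).
Hypothesis S_cone : forall m, S m ->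
  exists h a : int, [/\ m = comb w f h a, 0 <= a & a <= r * h].
Hypothesis S_edge : forall i : int, 0 <= i -> i <= r -> S (comb w f 1 i).

Let wf0 : det2 w f != 0. Proof. by apply/eqP => d0; move: dwf; rewrite d0. Qed.

Lemma cone_nspan (h : nat) (a : int) : 0 <= a -> a <= r * h%:Z -> nspan S (comb w f h%:Z a).
Proof.
elim: h a => [|h IHh] a a0 ah.
  have -> : a = 0 by lia.
  by rewrite comb00; exact: nspan0.
pose i : int := if a <= r then a else r.
have -> : comb w f h.+1%:Z a = comb w f 1 i + comb w f h%:Z (a - i).
  by rewrite combD; congr (comb _ _ _ _); lia.
have [i0 ir ai0 aih] : [/\ 0 <= i, i <= r, 0 <= a - i & a - i <= r * h%:Z].
  have e : r * h.+1%:Z = r * h%:Z + r by rewrite -addn1 PoszD mulrDr mulr1.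
  have : 0 <= r * h%:Z by rewrite mulr_ge0 //; lia.
  by rewrite /i; case: (lerP a r) => ar; split; lia.
by apply: nspanS; [exact: S_edge | exact: IHh].
Qed.

(** An exponent [q] of height [h2] at least 2 decomposes as [e_c + e_d + s] with
    [s] in the semigroup and [e_d] not proportional to [p].  Then [e_d - q] is an
    exponent of the chart, and [(e_d - q) + s = - e_c] makes [e_c] invertible. *)
Lemma tall_unit h1 a1 h2 a2 T :
  1 <= h1 -> 0 <= a1 -> a1 <= r * h1 ->
  2 <= h2 -> 0 <= a2 -> a2 <= r * h2 ->
  h1 * a2 - a1 * h2 != 0 ->
  (forall s, nash_exps S (comb w f h1 a1) (comb w f h2 a2) s -> T s) -> has_unit T.
Proof.
move=> h11 a10 a1r h22 a20 a2r d0 ST.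
have [c [d [c0 cr d00 dr [dh e0 er]]]] : exists c d : int, [/\ 0 <= c, c <= r, 0 <= d, d <= r &
    [/\ d * h1 != a1, 0 <= a2 - c - d & a2 - c - d <= r * (h2 - 2)]].
  have rh : 0 <= r * (h2 - 2) by rewrite mulr_ge0 //; lia.
  have rhE : r * (h2 - 2) = r * h2 - 2 * r by ring.
  have [a2z|a2z] := eqVneq a2 0.
    exists 0, 0; split; try lia; split; try lia.
  have [a2R|a2R] := eqVneq a2 (r * h2).
    exists r, r; split; try lia; split; try lia.
  (* [t = c + d] between 1 and [2 r - 1] is a sum of two distinct values [x] and
   [t - x], one of which is not the slope of [p]. *)
  pose t := if a2 <= 2 * r - 1 then a2 else 2 * r - 1.
  have [t1 t2 t3 t4] : [/\ 1 <= t, t <= 2 * r - 1, 0 <= a2 - t & a2 - t <= r * (h2 - 2)].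
    by rewrite /t; case: (lerP a2 (2 * r - 1)) => at2; split; lia.
  pose x : int := if t <= r then 0 else t - r.
  have [x0 xr y0 yr xy] : [/\ 0 <= x, x <= r, 0 <= t - x, t - x <= r & x != t - x].
    by rewrite /x; case: (lerP t r) => tr; split; lia.
  have [xh|xh] := eqVneq (x * h1) a1.
    exists x, (t - x); split; try lia; split; try lia.
    rewrite -xh; apply: contraNneq xy => e.
    have h10 : h1 != 0 by lia.
    by rewrite -(inj_eq (mulIf h10)) e.
  by exists (t - x), x; split; try lia; split; try lia.
have Sd : T (comb w f 1 d - comb w f h2 a2).
  apply/ST/Or33; exists (comb w f 1 d); split=> //; first exact: S_edge.
  by rewrite det_comb mulf_neq0 // mul1r subr_eq0 eq_sym.
have SE m : nspan S m -> nspan T m by apply: nspan_mono => s Ss; apply/ST/Or31.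
have Nc : nspan T (- comb w f 1 c).
  have -> : - comb w f 1 c =
      (comb w f 1 d - comb w f h2 a2) + comb w f (absz (h2 - 2))%:Z (a2 - c - d).
    have -> : (absz (h2 - 2))%:Z = h2 - 2 by lia.
    by rewrite !combN !combD; congr (comb _ _ _ _); ring.
  apply: nspanS => //; apply/SE/cone_nspan => //.
  by have -> : (absz (h2 - 2))%:Z = h2 - 2 by lia.
pose c' : int := if c < r then c + 1 else c - 1.
have [c'0 c'r] : 0 <= c' /\ c' <= r by rewrite /c'; case: ifP; lia.
exists (comb w f 1 c), (comb w f 1 c'); split=> //; try by apply/SE/nspan1/S_edge.
rewrite det_comb normrM dwf mulr1 /c'; case: ifP => _; lia.
Qed.

(** For exponents [e_i] and [e_j] of height 1, differences of the generators give
    both [f] and [- f], except when [e_i] and [e_j] are the two generators next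
    to an end of the segment.  There the chart is the affine plane with
    coordinates of exponents [e_0], [f], or [e_r], [- f]. *)
Lemma flat_smooth (i j : int) : 0 <= i -> i < j -> j <= r ->
  smooth_exps (nash_exps S (comb w f 1 i) (comb w f 1 j)).
Proof.
move=> i0 ij jr; set T := nash_exps _ _ _.
have Ti k : 0 <= k -> k <= r -> k != j -> nspan T (comb w f 0 (k - i)).
  move=> k0 kr kj; apply/nspan1/Or32; exists (comb w f 1 k); split; first exact: S_edge.
    by rewrite det_comb mulf_neq0 //; lia.
  by rewrite combN combD; congr (comb _ _ _ _); ring.
have Tj k : 0 <= k -> k <= r -> k != i -> nspan T (comb w f 0 (k - j)).
  move=> k0 kr ki; apply/nspan1/Or33; exists (comb w f 1 k); split; first exact: S_edge.
    by rewrite det_comb mulf_neq0 //; lia.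
  by rewrite combN combD; congr (comb _ _ _ _); ring.
have Te k : 0 <= k -> k <= r -> nspan T (comb w f 1 k).
  by move=> k0 kr; apply/nspan1/Or31/S_edge.
have [/andP[/eqP ie /eqP je]|ne1] := boolP ((i == 0) && (j == 1)).
  exists (comb w f 1 0), (comb w f 0 1); split; first by apply: Te; lia.
    by have := Tj 2; rewrite je; apply; lia.
  left; suff E (h a : int) : 0 <= h -> 0 <= a ->
      exists x y : nat, comb w f h a = comb w f 1 0 *+ x + comb w f 0 1 *+ y.
    move=> m; rewrite /T ie je.
    case=> [/S_cone[h [a [-> a0 ah]]]|[s [/S_cone[h [a [-> a0 ah]]]]]|[s [/S_cone[h [a [-> a0 ah]]]]]].
    - by apply: E => //; nia.
    - rewrite det_comb => d0 ->; rewrite combN combD; apply: E; last lia.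
      have {}d0 : h * 1 - a * 1 != 0 by apply: contraNneq d0 => ->; rewrite mul0r.
      nia.
    rewrite det_comb => d0 ->; rewrite combN combD.
    have {}d0 : h * 0 - a * 1 != 0 by apply: contraNneq d0 => ->; rewrite mul0r.
    by apply: E; nia.
  move=> h0 a0; exists (absz h), (absz a).
  by rewrite !combMn combD; congr (comb _ _ _ _); lia.
have [/andP[/eqP ie /eqP je]|ne2] := boolP ((i == r - 1) && (j == r)).
  exists (comb w f 1 r), (comb w f 0 (-1)); split; first by apply: Te; lia.
    have := Ti (r - 2); rewrite ie je (_ : r - 2 - (r - 1) = -1); last by ring.
    by apply; lia.
  left; suff E (h a : int) : 0 <= h -> a <= r * h ->
      exists x y : nat, comb w f h a = comb w f 1 r *+ x + comb w f 0 (-1) *+ y.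
    move=> m; rewrite /T ie je.
    case=> [/S_cone[h [a [-> a0 ah]]]|[s [/S_cone[h [a [-> a0 ah]]]]]|[s [/S_cone[h [a [-> a0 ah]]]]]].
    - by apply: E => //; nia.
    - rewrite det_comb => d0 ->; rewrite combN combD.
      have {}d0 : h * r - a * 1 != 0 by apply: contraNneq d0 => ->; rewrite mul0r.
      by apply: E; nia.
    rewrite det_comb => d0 ->; rewrite combN combD.
    have {}d0 : h * (r - 1) - a * 1 != 0 by apply: contraNneq d0 => ->; rewrite mul0r.
    by apply: E; nia.
  move=> h0 a0; exists (absz h), (absz (r * h - a)%R).
  rewrite !combMn combD; congr (comb _ _ _ _); first by lia.
  have -> : (absz h)%:Z = h by lia.
  have -> : (absz (r * h - a)%R)%:Z = r * h - a by lia.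
  by ring.
apply: has_unit_smooth; exists (comb w f 0 1), (comb w f 1 0); split.
- have [jr'|jr'] := eqVneq j r.
    by have := Ti (i + 1); rewrite (_ : i + 1 - i = 1); [apply; lia | ring].
  by have := Tj (j + 1); rewrite (_ : j + 1 - j = 1); [apply; lia | ring].
- rewrite combN oppr0; have [i0'|i0'] := eqVneq i 0.
    by have := Tj (j - 1); rewrite (_ : j - 1 - j = -1); [apply; lia | ring].
  by have := Ti (i - 1); rewrite (_ : i - 1 - i = -1); [apply; lia | ring].
- by apply: Te; lia.
by rewrite det_comb normrM dwf; lia.
Qed.

Lemma cone_smooth p q : S p -> S q -> det2 p q != 0 -> smooth_exps (nash_exps S p q).
Proof.
move=> /S_cone[h1 [a1 [-> a10 ah1]]] /S_cone[h2 [a2 [-> a20 ah2]]].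
rewrite det_comb => d0; have {}d0 : h1 * a2 - a1 * h2 != 0.
  by apply: contraNneq d0 => ->; rewrite mul0r.
have h10 : 1 <= h1 by nia.
have h20 : 1 <= h2 by nia.
have [h22|h22] := lerP 2 h2.
  by apply: has_unit_smooth; apply: (tall_unit h10 a10 ah1 h22 a20 ah2 d0).
have [h12|h12] := lerP 2 h1.
  apply: has_unit_smooth; apply: (tall_unit h20 a20 ah2 h12 a10 ah1); last exact: nash_swap.
  by apply: contraNneq d0 => e; apply/eqP; lia.
have h1E : h1 = 1 by lia.
have h2E : h2 = 1 by lia.
rewrite h1E h2E in d0 ah1 ah2 *.
have [a12|a12] := lerP a1 a2.
  by apply: flat_smooth; lia.
apply: (@smooth_ext (nash_exps S (comb w f 1 a2) (comb w f 1 a1))).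
  by move=> m; split; exact: nash_swap.
by apply: flat_smooth; lia.
Qed.

End Cone.
End Combinatorics.

(** * Chains of lattice vectors with g_k + g_(k+2) = 3 g_(k+1) *)

Section Chain.
Variables (g : nat -> int * int) (m : nat).
Hypothesis g_rec : forall k, g k + g k.+2 = g k.+1 *+ 3.
Hypothesis g_det : det2 (g 0) (g 1) = 1.
Hypothesis m2 : (2 <= m)%N.

Let S s := exists2 k, (k <= m)%N & s = g k.

Lemma chain_next k : g k.+2 = g k.+1 *+ 3 - g k.
Proof. by rewrite -g_rec addrC addKr. Qed.

Lemma chain_det k : det2 (g k) (g k.+1) = 1.
Proof.
elim: k => [|k IHk]; first exact: g_det.
by rewrite chain_next -[RHS]IHk /det2 !coordE; ring.
Qed.

(** In the basis [g k], [g k.+1] the coordinates follow the recurrence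
    [(a, b) -> (b, 3 b - a)], which preserves [2 a + 1 <= b]. *)
Lemma chain_up k d : exists a b : int,
  [/\ g (k + d).+1 = comb (g k) (g k.+1) (- a) b,
      g (k + d).+2 = comb (g k) (g k.+1) (- b) (3 * b - a),
      0 <= a, 2 * a + 1 <= b & (0 < d)%N -> 1 <= a].
Proof.
elim: d => [|d [a [b [E1 E2 a0 ab _]]]].
  exists 0, 1; rewrite addn0 oppr0 comb01; split=> //.
  by rewrite chain_next; apply: Z2P; rewrite !coordE; ring.
exists b, (3 * b - a); rewrite addnS; split; try lia; first exact: E2.
by rewrite chain_next E2 E1; apply: Z2P; rewrite !coordE; ring.
Qed.

Lemma chain_down k d : (d <= k)%N -> exists a b : int,
  [/\ g (k - d)%N = comb (g k) (g k.+1) b (- a),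
      g (k - d).+1 = comb (g k) (g k.+1) a (b - 3 * a),
      0 <= a, 2 * a + 1 <= b & (0 < d)%N -> 1 <= a].
Proof.
elim: d => [|d IHd] dk.
  exists 0, 1; rewrite subn0 oppr0 comb10; split=> //.
  by apply: Z2P; rewrite !coordE; ring.
have [a [b [E1 E2 a0 ab _]]] := IHd (ltnW dk).
exists b, (3 * b - a); split; try lia.
  have -> : g (k - d.+1)%N = g (k - d.+1).+1 *+ 3 - g (k - d.+1).+2.
    by rewrite chain_next; apply: Z2P; rewrite !coordE; ring.
  rewrite -subSn // subSS E1 E2; apply: Z2P; rewrite !coordE; ring.
rewrite -subSn // subSS E1; apply: Z2P; rewrite !coordE; ring.
Qed.

Lemma chain_det_lt i j : (i < j)%N -> 1 <= det2 (g i) (g j).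
Proof.
move=> ij; have [a [b [E _ a0 ab _]]] := chain_up i (j - i.+1).
have jE : (i + (j - i.+1)).+1 = j by lia.
rewrite jE in E; rewrite E -{1}(comb10 (g i) (g i.+1)) det_comb chain_det; lia.
Qed.

Lemma chain_det_neq i j : i != j -> det2 (g i) (g j) != 0.
Proof.
have anti u v : det2 u v = - det2 v u by rewrite /det2; ring.
by case: ltngtP => // /chain_det_lt; [|rewrite (anti (g i))]; lia.
Qed.

(** The differences [g k - g k.+1] decrease by [g k.+1] at each step. *)
Lemma chain_tele j k :
  g k - g k.+1 = \sum_(l < j) g (k.+1 + l)%N + (g (k + j)%N - g (k + j).+1).
Proof.
elim: j => [|j IHj]; first by rewrite big_ord0 add0r addn0.
rewrite IHj big_ord_recr /= -addrA; congr (_ + _).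
by rewrite addnS addSn chain_next; apply: Z2P; rewrite !coordE; ring.
Qed.

(** By [chain_tele], the sum of the exponents [g i.+1 - g i] and
    [g j.-1 - g j] is [- (g i.+1 + ... + g j.-1)], which is a nonempty sum of
    negatives of exponents; so [g i.+1] is invertible. *)
Lemma chain_far_unit i j : (i.+1 < j)%N -> (j <= m)%N ->
  has_unit (nash_exps S (g i) (g j)).
Proof.
move=> ij jm; set T := nash_exps _ _ _.
have Tg k : (k <= m)%N -> T (g k) by move=> km; apply: Or31; exists k.
have T1 : T (g i.+1 - g i).
  apply: Or32; exists (g i.+1); split=> //; first by exists i.+1 => //; lia.
  by apply: chain_det_neq; lia.
have T2 : T (g j.-1 - g j).
  apply: Or33; exists (g j.-1); split=> //; first by exists j.-1 => //; lia.
  by apply: chain_det_neq; lia.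
exists (g i.+1), (g i); split.
- by apply/nspan1/Tg; lia.
- have [d dE] : exists d, j = (i + d.+1).+1 by exists (j - i.+2)%N; lia.
  have := chain_tele d.+1 i; rewrite -dE (_ : (i + d.+1)%N = j.-1); last by rewrite dE.
  rewrite big_ord_recl addn0 => E.
  have -> : - g i.+1 = (g i.+1 - g i) + ((g j.-1 - g j) +
       \sum_(l < d) g (i.+1 + lift ord0 l)%N).
    rewrite -opprB E; move: (\sum_(l < d) _) => s.
    by apply: Z2P; rewrite !coordE; ring.
  apply: nspanS => //; apply: nspanS => //.
  elim/big_ind: _ => [|a b|l _]; [exact: nspan0 | exact: nspanD |].
  by apply/nspan1/Tg; rewrite lift0 dE in jm *; have := ltn_ord l; lia.
- by apply/nspan1/Tg; lia.
have -> : det2 (g i.+1) (g i) = - det2 (g i) (g i.+1) by rewrite /det2; ring.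
by rewrite chain_det.
Qed.

(** The inequalities place all the generators other than [g k] and [g k.+1] above
    the line [x + y = 1]. *)
Lemma chain_coord k s : (k < m)%N -> S s -> exists x y : int,
  s = comb (g k) (g k.+1) x y /\
  [\/ x = 1 /\ y = 0, x = 0 /\ y = 1,
      [/\ (k.+1 < m)%N, x <= -1 & 1 - 2 * x <= y] |
      [/\ (0 < k)%N, y <= -1 & 1 - 2 * y <= x]].
Proof.
move=> km [j jm ->].
have [->|jk] := eqVneq j k; first by exists 1, 0; rewrite comb10; split=> //; apply: Or41.
have [->|jk1] := eqVneq j k.+1.
  by exists 0, 1; rewrite comb01; split=> //; apply: Or42.
have [kj|kj] := leqP j k.
  have [a [b [E _ a0 ab a1]]] := chain_down (leq_subr j k).
  rewrite subKn // in E; exists b, (- a); split=> //; apply: Or44.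
  by have {}a1 : 1 <= a by [apply: a1; lia]; split; lia.
have [a [b [E _ a0 ab a1]]] := chain_up k (j - k.+1).
have jE : (k + (j - k.+1)).+1 = j by lia.
rewrite jE in E; exists (- a), b; split=> //; apply: Or43.
by have {}a1 : 1 <= a by [apply: a1; lia]; split; lia.
Qed.

Section Adjacent.
Variable k : nat.
Hypothesis km : (k < m)%N.
Let p := g k.
Let q := g k.+1.
Let T := nash_exps S p q.

Let Sp : S p. Proof. by exists k => //; apply: ltnW. Qed.
Let Sq : S q. Proof. by exists k.+1. Qed.

(** The last four inequalities bound the cone by the exponents nearest to its
    edges, which are [3 q - 2 p] if there is a generator after [q], and otherwise
    [q]; symmetrically on the side of [p]. *)
Lemma adjacent_coord s : T s -> exists x y : int,
  s = comb p q x y /\ [/\ 0 <= x + y, (k.+1 < m)%N || (0 <= x),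
    (0 < k)%N || (0 <= y), 0 <= 3 * x + 2 * y & 0 <= 2 * x + 3 * y].
Proof.
have detq x y : det2 (comb p q x y) q = x.
  by rewrite -{2}(comb01 p q) det_comb chain_det; ring.
have detp x y : det2 (comb p q x y) p = - y.
  by rewrite -{2}(comb10 p q) det_comb chain_det; ring.
case=> [/(chain_coord km)[x [y [-> H]]]|[s' [/(chain_coord km)[x [y [-> H]]]]]
  |[s' [/(chain_coord km)[x [y [-> H]]]]]].
- exists x, y; split=> //.
  by case: H => [[-> ->]|[-> ->]|[->]|[->]] *; split; lia.
- rewrite detq => x0 ->; exists (x - 1), y; split.
    by apply: Z2P; rewrite !coordE; ring.
  by case: H x0 => [[-> ->]|[-> ->]|[->]|[->]] *; split; lia.
rewrite detp => y0 ->; exists x, (y - 1); split.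
  by apply: Z2P; rewrite !coordE; ring.
by case: H y0 => [[-> ->]|[-> ->]|[->]|[->]] *; split; lia.
Qed.

Let Tp : T (comb p q 1 0). Proof. by rewrite comb10; apply: Or31. Qed.
Let Tq : T (comb p q 0 1). Proof. by rewrite comb01; apply: Or31. Qed.

Let Tup : (k.+1 < m)%N -> T (comb p q (-2) 3) /\ T (comb p q (-1) 2).
Proof.
move=> km'; have S2 : S (g k.+2) by exists k.+2.
split; [apply: Or32 | apply: Or33]; exists (g k.+2); split=> //.
- by apply: chain_det_neq; lia.
- by rewrite chain_next -/p -/q; apply: Z2P; rewrite !coordE; ring.
- by apply: chain_det_neq; lia.
by rewrite chain_next -/p -/q; apply: Z2P; rewrite !coordE; ring.
Qed.

Let Tdown : (0 < k)%N -> T (comb p q 2 (-1)) /\ T (comb p q 3 (-2)).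
Proof.
move=> k0; have S1 : S (g k.-1) by exists k.-1 => //; lia.
have kE : g k.-1 = p *+ 3 - q.
  by rewrite /p /q -{2 3}(prednK k0) -g_rec addrK.
split; [apply: Or32 | apply: Or33]; exists (g k.-1); split=> //.
- by apply: chain_det_neq; lia.
- by rewrite kE; apply: Z2P; rewrite !coordE; ring.
- by apply: chain_det_neq; lia.
by rewrite kE; apply: Z2P; rewrite !coordE; ring.
Qed.

(** Between these extreme exponents the lattice points of the segment
    [x + y = 1] are all exponents of the chart.  There are 6 of them when the
    pair has neighbours on both sides, and 4 when it sits at an end of the
    chain, which has at least three terms. *)
Lemma adjacent_smooth p' q' : T p' -> T q' -> det2 p' q' != 0 ->
  smooth_exps (nash_exps T p' q').
Proof.
have dpq : det2 p q = 1 by exact: chain_det.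
have [km'|km'] := ltnP k.+1 m; last first.
  have k0 : (0 < k)%N by lia.
  have [d1 d2] := Tdown k0.
  apply: (@cone_smooth (comb p q 0 1) (comb p q 1 (-1)) 3) => //.
  - by rewrite det_comb dpq.
  - move=> s /adjacent_coord[x [y [-> [h1 h2 h3 h4 h5]]]]; exists (x + y), x.
    split; try lia.
    by apply: Z2P; rewrite !coordE; ring.
  move=> i i0 i3; have : [|| i == 0, i == 1, i == 2 | i == 3] by lia.
  have e x y : comb (comb p q 0 1) (comb p q 1 (-1)) x y = comb p q y (x - y).
    by apply: Z2P; rewrite !coordE; ring.
  by rewrite e => /or4P[] /eqP->.
have [u1 u2] := Tup km'.
have e x y : comb (comb p q (-2) 3) (comb p q 1 (-1)) x y = comb p q (y - 2 * x) (3 * x - y).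
  by apply: Z2P; rewrite !coordE; ring.
have dwf : `|det2 (comb p q (-2) 3) (comb p q 1 (-1))| = 1 by rewrite det_comb dpq.
have [k0|k0] := posnP k.
  apply: (@cone_smooth _ _ 3 _ dwf) => //.
    move=> s /adjacent_coord[x [y [-> [h1 h2 h3 h4 h5]]]].
    exists (x + y), (3 * x + 2 * y); split; try lia.
    by rewrite e; congr (comb _ _ _ _); ring.
  move=> i i0 i3; have : [|| i == 0, i == 1, i == 2 | i == 3] by lia.
  by rewrite e => /or4P[] /eqP->.
have [d1 d2] := Tdown k0.
apply: (@cone_smooth _ _ 5 _ dwf) => //.
  move=> s /adjacent_coord[x [y [-> [h1 h2 h3 h4 h5]]]].
  exists (x + y), (3 * x + 2 * y); split; try lia.
  by rewrite e; congr (comb _ _ _ _); ring.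
move=> i i0 i5; have : [|| i == 0, i == 1, i == 2 | [|| i == 3, i == 4 | i == 5]] by lia.
by rewrite e => /or4P[/eqP->|/eqP->|/eqP->|/or3P[] /eqP->].
Qed.

End Adjacent.

Lemma two_steps_smooth p q p' q' T T' :
  S p -> S q -> det2 p q != 0 -> (forall s, T s <-> nash_exps S p q s) ->
  T p' -> T q' -> det2 p' q' != 0 -> (forall s, T' s <-> nash_exps T p' q' s) ->
  smooth_exps T'.
Proof.
move=> Sp Sq dpq TE Tp Tq dpq' TE'.
suff H : smooth_exps (nash_exps T p' q').
  by apply: smooth_ext H => s; split=> /TE'.
wlog [i [j [ij jm pE qE]]] : p q Sp Sq dpq TE / exists i j, [/\ (i < j)%N, (j <= m)%N, p = g i & q = g j].
  move=> W; case: (Sp) (Sq) => [i im pE] [j jm qE].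
  have det0 u : det2 u u = 0 by rewrite /det2; ring.
  case: (ltngtP i j) => ij.
  - by apply: (W p q) => //; exists i, j.
  - apply: (W q p) => //; last by exists j, i.
      by apply: contraNneq dpq => d0; apply/eqP; move: d0; rewrite /det2; lia.
    by move=> s; split=> [/TE|/nash_swap/TE //]; exact: nash_swap.
  by move: dpq; rewrite pE qE ij det0 eqxx.
rewrite {}pE {}qE in dpq TE Sp Sq.
have nashE s : nash_exps (nash_exps S (g i) (g j)) p' q' s <-> nash_exps T p' q' s.
  by split; apply: nash_mono => s' /TE.
apply: (smooth_ext nashE).
have [ij1|ij1] := eqVneq j i.+1.
  rewrite ij1 in jm nashE TE *.
  by apply: adjacent_smooth => //; exact/TE.
apply/has_unit_smooth/has_unit_mono; last first.
  by apply: (@chain_far_unit i j) => //; lia.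
by move=> s Hs; apply: Or31.
Qed.

End Chain.

(** * Toric varieties and the Fibonacci chain *)

Section ToricVariety.
Context {C : numFieldType}.

Definition gen_exponent n (Gamma : 'I_n -> 'rV[int]_2) (k : 'I_n) : int * int :=
  (Gamma k 0 0, Gamma k 0 1).

Lemma mdegZ_toric n (Gamma : 'I_n -> 'rV[int]_2) (a : 'X_{1..n}) :
  mdegZ (gen_exponent Gamma) a = (toric_degree Gamma a 0 0, toric_degree Gamma a 0 1).
Proof.
apply: Z2P; rewrite /= summxE.
  rewrite /mdegZ (big_morph fst fstD erefl); apply: eq_bigr => k _.
  by rewrite fstMn mulmxnE -mulr_natr natz.
rewrite /mdegZ (big_morph snd sndD erefl); apply: eq_bigr => k _.
by rewrite sndMn mulmxnE -mulr_natr natz.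
Qed.

Lemma toric_degree_eq n (Gamma : 'I_n -> 'rV[int]_2) (a b : 'X_{1..n}) :
  toric_degree Gamma a = toric_degree Gamma b <->
  mdegZ (gen_exponent Gamma) a = mdegZ (gen_exponent Gamma) b.
Proof.
rewrite !mdegZ_toric; split=> [->//|[e0 e1]]; apply/rowP => i.
have one : lift ord0 ord0 = 1 :> 'I_2 by apply: val_inj.
by case: (unliftP ord0 i) => [j ->|->]; rewrite ?(ord1 j) ?one.
Qed.

(** Density: at a point [x] of the toric variety the monomial [x ^ a] depends only
    on the degree of [a]; so [char_indep] applies to a polynomial vanishing on
    the torus, with the values of the monomials at [x] in place of those of a
    character. *)
Lemma toric_variety_toric n (Gamma : 'I_n -> 'rV[int]_2) p q :
  det2 (gen_exponent Gamma p) (gen_exponent Gamma q) != 0 ->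
  toric (gen_exponent Gamma) (fun=> 1 : C) (toric_variety Gamma).
Proof.
move=> dpq; split; last by exists p, q; rewrite !oner_eq0.
- move=> chi cc f [s [sS ->]].
  rewrite raddf_sum big_seq big1 // => gh /sS[a [b [/toric_degree_eq ab ghE]]].
  have XE (e : 'X_{1..n}) : ('X_[e] : {mpoly C[n]}).@[torus_pt (gen_exponent Gamma) (fun=> 1) chi ord0] =
      chi (mdegZ (gen_exponent Gamma) e).
    rewrite mevalX char_sum //; apply: eq_bigr => k _.
    by rewrite mxE mul1r charMn.
  by rewrite /= mevalM ghE mevalB !XE ab subrr mulr0.
move=> f fT x Yx.
have xE a b : mdegZ (gen_exponent Gamma) a = mdegZ (gen_exponent Gamma) b ->
    \prod_k x 0 k ^+ a k = \prod_k x 0 k ^+ b k.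
  move=> ab; apply/eqP; rewrite -subr_eq0 -!(mevalX (x ord0)) -mevalB; apply/eqP/Yx.
  exists [:: (1, 'X_[a] - 'X_[b])]; split=> [gh|].
    by rewrite inE => /eqP->; exists a, b; split=> //; apply/toric_degree_eq.
  by rewrite big_seq1 mul1r.
have /choice[g gE] m : exists z, forall a, mdegZ (gen_exponent Gamma) a = m ->
    \prod_k x 0 k ^+ a k = z.
  have [[a am]|nex] := pselect (exists a, mdegZ (gen_exponent Gamma) a = m).
    by exists (\prod_k x 0 k ^+ a k) => b bm; apply: xE; rewrite bm.
  by exists 0 => a am; case: nex; exists a.
rewrite mevalE.
have key chi : is_char chi ->
    \sum_(a <- msupp f) f@_a * chi (mdegZ (gen_exponent Gamma) a) = 0.
  move=> cc; rewrite -[RHS](fT _ (ex_intro2 _ _ chi cc erefl)) meval_torus_pt //.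
  apply: eq_bigr => a _; rewrite big1 ?mulr1 // => k _; exact: expr1n.
rewrite -[RHS](char_indep key g); apply: eq_bigr => a _.
by rewrite (gE _ a erefl).
Qed.

End ToricVariety.

(** The index 0 is special: the formula for positive indices would give
    [(fib 0, fib 0) = (0, 0)]. *)
Definition fib_chain (k : nat) : int * int :=
  if k is 0 then (1, 0) else ((fib (k.*2).-1)%:Z, (fib k.*2)%:Z).

Lemma fib_chain_rec k : fib_chain k + fib_chain k.+2 = fib_chain k.+1 *+ 3.
Proof.
apply: Z2P; rewrite !coordE; case: k => [|k] //.
  rewrite /fib_chain !doubleS /= ; lia.
rewrite /fib_chain !doubleS /=; lia.
Qed.

Lemma fib_exponents (C : numFieldType) l s :
  exponents (gen_exponent (fib_Gamma l)) (fun=> 1 : C) s <->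
  exists2 k, (k <= l./2)%N & s = fib_chain k.
Proof.
have gE (k : 'I_(l./2).+1) : gen_exponent (fib_Gamma l) k = fib_chain k.
  by rewrite /gen_exponent /fib_Gamma !mxE /=; case: k => -[].
split=> [[k _ <-]|[k kl ->]]; first by exists k; rewrite ?gE // -ltnS.
by exists (Ordinal (kl : (k < (l./2).+1)%N)); rewrite ?oner_eq0 // gE.
Qed.

Theorem theorem2 (R : realType) (l : nat) (hl4 : (4 <= l)%N) (hl : ~~ odd l) :
  nonsingular
    (nash_blowup (nash_blowup (affine_variety (toric_variety (C := R[i]%C) (fib_Gamma l))))).
Proof.
case=> [[[] /= J] K] y /= Ky.
have l2 : (2 <= l./2)%N by lia.
set X := toric_variety _ in Ky *.
pose e := gen_exponent (fib_Gamma l).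
have [p Ep] : exists p, e p = fib_chain 0.
  have [|p _ pE] := proj2 (@fib_exponents R[i] l (fib_chain 0)); first by exists 0%N.
  by exists p.
have [q Eq] : exists q, e q = fib_chain 1.
  have [|q _ qE] := proj2 (@fib_exponents R[i] l (fib_chain 1)); first by exists 1%N => //; lia.
  by exists q.
have tX : toric e (fun=> 1) X.
  by apply: (@toric_variety_toric _ _ _ p q); rewrite -/e Ep Eq.
have [_ [/= Jy _]] := Ky.
have [p1 [q1 [e1 [c1 [Sp1 Sq1 d1 t1 E1]]]]] := nash_toric tX Jy.
have [p2 [q2 [e2 [c2 [Sp2 Sq2 d2 t2 E2]]]]] := nash_toric t1 Ky.
apply: (toric_smooth t2 _ Ky).
have fE := @fib_exponents R[i] l.
apply: (@two_steps_smooth fib_chain l./2 fib_chain_rec erefl l2 p1 q1 p2 q2 (exponents e1 c1)) => //.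
- exact/fE.
- exact/fE.
by move=> s; split=> [/E1 H|H]; last apply/E1; apply: (nash_mono _ H) => s' /fE.
Qed.
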